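(* If $k=1$ or $k=2$, then $\mathcal F_k^L(\mathcal M_{g,1})=\mathcal F_k(\mathcal M_{g,1})\cdot\mathcal F_\infty^L(\mathcal M_{g,1})$.
   Context: $\Sigma_{g,1}$ is the compact oriented surface of genus $g$ with one boundary component, $\Sigma_g$ the closed oriented surface obtained by attaching a disk, and $\mathcal M_{g,1}$ the mapping class group of $\Sigma_{g,1}$: isotopy classes rel boundary of orientation-preserving diffeomorphisms which are the identity on $\partial\Sigma_{g,1}$. $F=\pi_1(\Sigma_{g,1})$ is free on $x_1,\dots,x_g,y_1,\dots,y_g$, representing a system of meridian and longitude curves, and $\mathcal M_{g,1}$ is identified (Dehn–Nielsen–Baer) with the group of automorphisms of $F$ fixing $\delta=[x_1,y_1]\cdots[x_g,y_g]$; write $h_*$ for the automorphism induced by $h$. $T_g$ is a handlebody bounded by $\Sigma_g$, $i:\Sigma_{g,1}\to T_g$ is the inclusion, and the basis is chosen so that the $x_j$ are null-homotopic in $T_g$, and hence $i_*(y_1),\dots,i_*(y_g)$ is a basis of the free group $F'=\pi_1(T_g)$. For a group $G$, $G_q$ denotes the $q$-th term of its lower central series ($G_1=G$). The Johnson filtration: $\mathcal F_k(\mathcal M_{g,1})$ is the (normal) subgroup of all $h\in\mathcal M_{g,1}$ inducing the identity automorphism of $F/F_{k+1}$; $\mathcal F_1(\mathcal M_{g,1})$ is the Torelli group. The Lagrangian filtration: for $k\ge1$, $\mathcal F_k^L(\mathcal M_{g,1})$ is the subgroup of all $h\in\mathcal M_{g,1}$ such that for all $j$: (1) $i_*h_*(x_j)\in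 F'_{k+1}$, and (2) $h_*(x_j)\equiv x_j\bmod F_2$. Put $\mathcal F_\infty^L(\mathcal M_{g,1})=\bigcap_k\mathcal F_k^L(\mathcal M_{g,1})$; it is known that this equals $\mathcal B_g\cap\mathcal F_1^L(\mathcal M_{g,1})$, where $\mathcal B_g\subseteq\mathcal M_{g,1}$ is the subgroup of diffeomorphisms which (extended by the identity over the disk to $\Sigma_g$) extend to diffeomorphisms of $T_g$. The product $A\cdot B$ of subgroups denotes $\{ab: a\in A,\ b\in B\}$. *)

(* Defs.v *)
From HB Require Import structures.
From mathcomp Require Import all_boot.
From mathcomp Require Import boolp classical_sets.

Set Implicit Arguments.
Unset Strict Implicit.
Unset Printing Implicit Defensive.

Local Open Scope classical_set_scope.
Local Open Scope group_scope.

(** * The free group on a type of generators, as reduced words.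
    The letter [(t, true)] stands for [t], and [(t, false)] for [t^-1]. *)
Section FreeGroup.
Variable T : choiceType.
Local Notation letter := (T * bool)%type.

Definition linv (a : letter) : letter := (a.1, ~~ a.2).

Definition reduced (w : seq letter) : bool :=
  sorted (fun a b => b != linv a) w.

Record fgroup := FGroup { fword :> seq letter; _ : reduced fword }.

HB.instance Definition _ := [isSub for fword].
HB.instance Definition _ := [Choice of fgroup by <:].

Definition push (a : letter) (w : seq letter) : seq letter :=
  if w is b :: w' then (if b == linv a then w' else a :: w) else [:: a].

Definition concat_red (u w : seq letter) : seq letter := foldr push w u.

Lemma linvK : involutive linv.
Proof. by case=> t b; rewrite /linv /= negbK. Qed.

Lemma reduced_push a w : reduced w -> reduced (push a w).
Proof.
case: w => [|b w] //= rw; case: ifPn => [_|nb]; first exact: path_sorted rw.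
by rewrite /reduced /= nb.
Qed.

Lemma reduced_concat u w : reduced w -> reduced (concat_red u w).
Proof. by move=> rw; elim: u => //= a u; apply: reduced_push. Qed.

Lemma pushK a w : reduced w -> push a (push (linv a) w) = w.
Proof.
case: w => [|b w] /=; first by rewrite eqxx.
rewrite linvK; case: eqP => [->|_] rw /=; last by rewrite eqxx.
case: w rw => [|c w] //= /andP[nc _].
by rewrite (negPf nc).
Qed.

Lemma concat_push a u w : reduced w ->
  concat_red (push a u) w = push a (concat_red u w).
Proof.
move=> rw; case: u => [|b u] //=; case: eqP => [->|_] //=.
by rewrite pushK // reduced_concat.
Qed.

Lemma concat_redA u v w : reduced w ->
  concat_red (concat_red u v) w = concat_red u (concat_red v w).
Proof. by move=> rw; elim: u => //= a u IH; rewrite concat_push // IH. Qed.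

Lemma concat_nil u : reduced u -> concat_red u [::] = u.
Proof.
elim: u => //= a u IH rau; rewrite IH; last exact: path_sorted rau.
by case: u rau {IH} => [|b u] //= /andP[/negPf ->].
Qed.

Definition winv (w : seq letter) : seq letter := rev (map linv w).

Lemma reduced_winv w : reduced w -> reduced (winv w).
Proof.
rewrite /reduced /winv rev_sorted sorted_map; apply: sub_sorted => a b /=.
by rewrite linvK eq_sym.
Qed.

Lemma concat_winv w u : reduced u -> concat_red (winv w) (concat_red w u) = u.
Proof.
move=> ru; elim: w => //= a w IH.
rewrite /winv /= rev_cons -cats1 /concat_red foldr_cat /=.
by rewrite -{2}[a]linvK pushK ?reduced_concat.
Qed.

Definition fmul (u w : fgroup) : fgroup :=
  FGroup (reduced_concat (fword u) (valP w)).
Definition fone : fgroup := @FGroup [::] isT.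
Definition finv (u : fgroup) : fgroup := FGroup (reduced_winv (valP u)).

Lemma fmulA : associative fmul.
Proof. by move=> u v w; apply: val_inj; rewrite /= concat_redA ?(valP w). Qed.
Lemma fmul1 : left_id fone fmul.
Proof. by move=> u; apply: val_inj. Qed.
Lemma fmulr1 : right_id fone fmul.
Proof. by move=> u; apply: val_inj; rewrite /= concat_nil ?(valP u). Qed.
Lemma fmulV : left_inverse fone finv fmul.
Proof.
move=> u; apply: val_inj => /=.
by rewrite -{2}(concat_nil (valP u)) concat_winv.
Qed.
Lemma finvK : involutive finv.
Proof.
move=> u; apply: val_inj; rewrite /= /winv map_rev revK -map_comp.
by rewrite map_id_in // => a _ /=; rewrite linvK.
Qed.
Lemma fmulVr : right_inverse fone finv fmul.
Proof. by move=> u; rewrite -{1}[u]finvK fmulV. Qed.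

HB.instance Definition _ := isGroup.Build fgroup fmulA fmul1 fmulr1 fmulV fmulVr.

Definition fgen (t : T) : fgroup := @FGroup [:: (t, true)] isT.

(** The universal property: [flift f] is the homomorphism extending [f]. *)
Section Lift.
Variables (G : groupType) (f : T -> G).

Definition lval (a : letter) : G := if a.2 then f a.1 else (f a.1)^-1.

Definition flift (w : fgroup) : G := \prod_(a <- fword w) lval a.

Lemma lval_linv a : lval (linv a) = (lval a)^-1.
Proof. by case: a => t [] //=; rewrite /lval /= invgK. Qed.

Lemma prod_push a w :
  \prod_(b <- push a w) lval b = lval a * \prod_(b <- w) lval b.
Proof.
case: w => [|b w] /=; first by rewrite big_cons.
case: eqP => [->|_]; rewrite !big_cons //.
by rewrite lval_linv mulgA mulgV mul1g.
Qed.

Lemma flift_morph : {morph flift : u w / u * w}.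
Proof.
move=> [u ru] [w rw]; rewrite /flift /= /concat_red {ru}.
elim: u => [|a u IH] /=; first by rewrite big_nil mul1g.
by rewrite prod_push IH big_cons mulgA.
Qed.
Lemma flift_monoid : monoid_morphism flift.
Proof. by split; [rewrite /flift big_nil | exact: flift_morph]. Qed.
HB.instance Definition _ := isUMagmaMorphism.Build fgroup G flift flift_monoid.

Lemma flift_gen t : flift (fgen t) = f t.
Proof. by rewrite /flift big_seq1. Qed.

Lemma flift_unique (h : UMagmaMorphism.type fgroup G) :
  (forall t, h (fgen t) = f t) -> h =1 flift.
Proof.
move=> hf.
have hV t : h (@FGroup [:: (t, false)] isT) = (f t)^-1.
  by rewrite -hf -[RHS](gmulfV h); congr (h _); apply: val_inj.
case; elim=> [|a w IH] raw.
  rewrite /flift big_nil -[RHS](gmulf1 (s := h)); congr (h _); exact: val_inj.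
have rw : reduced w by exact: path_sorted raw.
have ra : reduced [:: a] by [].
have -> : FGroup raw = FGroup ra * FGroup rw.
  by apply: val_inj => /=; case: (w) raw => [|b v] //= /andP[/negPf ->].
rewrite !gmulfM IH; congr (_ * _); rewrite /= /flift big_seq1.
case: a ra {raw} => t [] ra; rewrite /lval /=.
  by rewrite -hf; congr (h _); apply: val_inj.
by rewrite -hV; congr (h _); apply: val_inj.
Qed.
End Lift.
End FreeGroup.

(** * Lower central series *)
Section LowerCentralSeries.
Variable G : groupType.

Definition is_subgroup (A : set G) : Prop :=
  A 1 /\ forall a b, A a -> A b -> A (a / b).

Definition gen_subgroup (A : set G) : set G := smallest is_subgroup A.

(** [lcs q] is the [q]-th term [G_q], numbered from [G_1 = G]; the index [0]
    is outside the usual range, and [lcs 0 = G]. *)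
Fixpoint lcs (q : nat) : set G :=
  if q is (p.+1 as q').+1
  then gen_subgroup [set c | exists a b, lcs q' b /\ c = [~ a, b]]
  else setT.

Definition eq_mod (N : set G) (a b : G) : Prop := N (a^-1 * b).
End LowerCentralSeries.
Arguments lcs G q : clear implicits.

(** * The mapping class group and its filtrations *)
Section MappingClassGroup.
Variable g : nat.

(** [pi_1] of the surface of genus [g] with one boundary component. *)
Definition Fsurf : Type := fgroup ('I_g + 'I_g)%type.
HB.instance Definition _ := Group.on Fsurf.

Definition xgen (j : 'I_g) : Fsurf := fgen (inl j).
Definition ygen (j : 'I_g) : Fsurf := fgen (inr j).

(** The boundary curve. Here [[~ a, b] = a^-1 * b^-1 * a * b]; replacing every
    [x_j], [y_j] by its inverse passes to the convention
    [a * b * a^-1 * b^-1] and preserves both filtrations below. *)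
Definition bdry : Fsurf := \prod_(j < g) [~ xgen j, ygen j].

(** [pi_1] of the handlebody: the classes of the [y_j] form a basis. *)
Definition Fhand : Type := fgroup 'I_g.
HB.instance Definition _ := Group.on Fhand.

Definition i_star : Fsurf -> Fhand :=
  flift (fun s : 'I_g + 'I_g =>
    match s with inl _ => 1 | inr j => fgen j end : Fhand).
HB.instance Definition _ := UMagmaMorphism.on i_star.

(** Mapping classes, through the Dehn-Nielsen-Baer identification with the
    automorphisms of the free group that fix the boundary word. *)
Record mcg := Mcg {
  star :> Fsurf -> Fsurf;
  star_morph : {morph star : u w / u * w};
  star_bij : bijective star;
  star_bdry : star bdry = bdry }.

Lemma star_monoid (h : mcg) : monoid_morphism (star h).
Proof.
split; last exact: star_morph.
by apply: (@mulgI _ (star h 1)); rewrite -star_morph !mulg1.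
Qed.
HB.instance Definition _ (h : mcg) :=
  isUMagmaMorphism.Build Fsurf Fsurf (star h) (star_monoid h).
HB.instance Definition _ := gen_eqMixin mcg.
HB.instance Definition _ := gen_choiceMixin mcg.

Lemma mcg_ext (h h' : mcg) : star h =1 star h' -> h = h'.
Proof.
case: h h' => f1 a1 b1 c1 [f2 a2 b2 c2] /= /funext e.
by subst f2; congr Mcg; apply: Prop_irrelevance.
Qed.

Definition mcg_one : mcg :=
  @Mcg id (fun _ _ => erefl) (Bijective (fun _ => erefl) (fun _ => erefl)) erefl.

Lemma comp_morph (a b : mcg) : {morph a \o b : u w / u * w}.
Proof. by move=> u w; rewrite /= !star_morph. Qed.
Lemma comp_bdry (a b : mcg) : (a \o b) bdry = bdry.
Proof. by rewrite /= !star_bdry. Qed.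

Definition mcg_mul (a b : mcg) : mcg :=
  Mcg (comp_morph a b) (bij_comp (star_bij a) (star_bij b)) (comp_bdry a b).

Lemma mcg_has_inv (h : mcg) : exists h' : mcg, cancel h h' /\ cancel h' h.
Proof.
have [k hk kh] := star_bij h.
have kM : {morph k : u w / u * w}.
  by move=> u w; apply: (can_inj hk); rewrite star_morph !kh.
have kd : k bdry = bdry by apply: (can_inj hk); rewrite kh star_bdry.
by exists (Mcg kM (Bijective kh hk) kd).
Qed.
Definition mcg_inv (h : mcg) : mcg := projT1 (cid (mcg_has_inv h)).
Lemma mcg_invK (h : mcg) : cancel h (mcg_inv h) /\ cancel (mcg_inv h) h.
Proof. exact: (projT2 (cid (mcg_has_inv h))). Qed.

Lemma mcg_mulA : associative mcg_mul.
Proof. by move=> a b c; apply: mcg_ext. Qed.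
Lemma mcg_mul1 : left_id mcg_one mcg_mul.
Proof. by move=> a; apply: mcg_ext. Qed.
Lemma mcg_mulr1 : right_id mcg_one mcg_mul.
Proof. by move=> a; apply: mcg_ext. Qed.
Lemma mcg_mulV : left_inverse mcg_one mcg_inv mcg_mul.
Proof. by move=> a; apply: mcg_ext => u /=; rewrite (mcg_invK a).1. Qed.
Lemma mcg_mulVr : right_inverse mcg_one mcg_inv mcg_mul.
Proof. by move=> a; apply: mcg_ext => u /=; rewrite (mcg_invK a).2. Qed.

HB.instance Definition _ :=
  isGroup.Build mcg mcg_mulA mcg_mul1 mcg_mulr1 mcg_mulV mcg_mulVr.

(** [h] induces the identity on the quotient of [Fsurf] by its [k+1]-st lower
    central term. *)
Definition johnson (k : nat) : set mcg :=
  [set h | forall w : Fsurf, eq_mod (lcs Fsurf k.+1) (h w) w].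

Definition lagrangian (k : nat) : set mcg :=
  [set h | forall j : 'I_g, lcs Fhand k.+1 (i_star (h (xgen j))) /\
                            eq_mod (lcs Fsurf 2) (h (xgen j)) (xgen j)].

Definition lagrangian_infty : set mcg :=
  \bigcap_(k in [set k : nat | (1 <= k)%N]) lagrangian k.
End MappingClassGroup.
Arguments johnson g k : clear implicits.
Arguments lagrangian g k : clear implicits.
Arguments lagrangian_infty g : clear implicits.

Definition set_mul (G : groupType) (A B : set G) : set G :=
  [set a * b | a in A & b in B].

(* Main.v *)
From HB Require Import structures.
Require Import Defs.
From mathcomp Require Import all_boot all_order all_algebra.
From mathcomp Require Import boolp classical_sets.
From mathcomp Require Import ring zify.

Set Implicit Arguments.
Unset Strict Implicit.
Unset Printing Implicit Defensive.

Import Order.TTheory GRing.Theory Num.Theory.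
Local Open Scope group_scope.

(** Let [H] be the abelianization of the surface group [F]. The inclusion of the
    product in [lagrangian g k] is formal. Conversely, given [h] in
    [lagrangian g k], the point is to find a handlebody class [b], acting on the
    [x_j] trivially in homology, with [h = b] modulo [F_(k+1)]: then
    [h = (h * b^-1) * b] is the required factorization
    ([lagrangian_compare]). Handlebody classes are obtained as explicit
    automorphisms [b] of [F] that fix the boundary word and send each [x_j] into
    the kernel of [i_star], as do their inverses ([haut]); for these
    [i_star (b (x_j)) = 1], which lies in every term of the lower central series.

    Congruences modulo [F_2] and [F_3] are read off from the first two
    coefficients [e1] and [e2] of the Magnus expansion, obtained from unitriangular
    representations of [F]: a word with vanishing linear coefficients lies in [F_2],
    and a word of [F_2] with vanishing quadratic coefficients lies in [F_3]
    ([lcs2_detect], [lcs3_detect]). The quadratic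
    coefficient of the boundary word is the intersection form, so every mapping
    class is symplectic on [H] ([bdry_sympl]).

    Case [k = 1]. As [h] fixes the classes of the [x_j], it is a transvection
    [y_k |-> y_k + \sum_l m l k x_l] of [H], and symplecticity makes [m]
    symmetric ([homology_twist]). Symmetric matrices are sums of elementary ones,
    realized by a shear [y_i |-> x_i y_i] and by the clasp of two feet of
    handles ([twist_sym]).

    Case [k = 2]. After the first case [h] may be taken in the Torelli group. Comparing
    the cubic coefficients of [h (bdry g)] and [bdry g] shows that the Johnson
    tensor of [h], which records [z^-1 * h z] modulo [F_3], is alternating
    ([tensor_cyc], [tensor_anti]), and the Lagrangian condition makes it vanish on
    triples of dual classes of the [y_j]. Such a tensor is an integral combination of
    the elementary alternating tensors [x_i /\ a /\ b] with [a] and [b] basis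
    elements. Pushing the handle [i] around the loop [y_j] realizes
    [x_i /\ y_i /\ y_j] ([push_realizable]); conjugation by handlebody classes,
    namely by transvections and by slides [y_i |-> y_i - y_j], transports the tensor
    by the action on [H] and yields all the others ([realizable_x1],
    [lagrangian_tensor_realized]). *)

(** * Homomorphisms out of a free group *)

Ltac gsimp := rewrite ?(conjgE, commgEl, invgM, invgK, invg1, mulg1, mul1g, mulgA);
  rewrite ?(mulgK, mulgVK, mulgV, mulVg, mulg1, mul1g).

Section Multiplicative.
Variables (G K : groupType) (f : G -> K).
Hypothesis fM : {morph f : x y / x * y}.

Lemma mult1 : f 1 = 1.
Proof. by apply: (mulgI (f 1)); rewrite -fM !mulg1. Qed.
Lemma multV x : f x^-1 = (f x)^-1.
Proof. by apply: (mulgI (f x)); rewrite -fM !mulgV mult1. Qed.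
Lemma multJ x y : f (x ^ y) = f x ^ f y.
Proof. by rewrite /conjg !fM multV. Qed.
Lemma multR x y : f [~ x, y] = [~ f x, f y].
Proof. by rewrite !commgEl fM multV multJ. Qed.
Lemma mult_prod (I : Type) (r : seq I) (F : I -> G) :
  f (\prod_(i <- r) F i) = \prod_(i <- r) f (F i).
Proof. exact: (big_morph f fM mult1). Qed.
End Multiplicative.

Section FreeGroupHom.
Variable T : choiceType.

Lemma fgroup_gen_ind (P : fgroup T -> Prop) :
  P 1 -> (forall t, P (fgen t)) -> (forall t, P (fgen t)^-1) ->
  (forall u w, P u -> P w -> P (u * w)) -> forall w, P w.
Proof.
move=> P1 Pg PV PM; case; elim=> [|a w IH] raw.
  by have -> : FGroup raw = 1 by apply: val_inj.
have rw : reduced w by exact: path_sorted raw.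
have ra : reduced [:: a] by [].
have -> : FGroup raw = FGroup ra * FGroup rw.
  by apply: val_inj => /=; case: (w) raw => [|b v] //= /andP[/negPf ->].
apply: PM; last exact: IH.
case: a ra {raw} => t [] ra.
  by have -> : FGroup ra = fgen t by apply: val_inj.
by have -> : FGroup ra = (fgen t)^-1 by apply: val_inj.
Qed.

Lemma eq_mult (G : groupType) (f f' : fgroup T -> G) :
  {morph f : x y / x * y} -> {morph f' : x y / x * y} ->
  (forall t, f (fgen t) = f' (fgen t)) -> f =1 f'.
Proof.
move=> fM f'M e; apply: fgroup_gen_ind => //; first by rewrite !mult1.
- by move=> t; rewrite !multV // e.
- by move=> u w eu ew; rewrite fM f'M eu ew.
Qed.

Definition letter_val (a : T * bool) : fgroup T := lval (@fgen T) a.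

Lemma fgroup_letters (w : fgroup T) : w = \prod_(a <- fword w) letter_val a.
Proof.
apply: (@eq_mult _ id (flift (@fgen T))) => //.
- exact: flift_morph.
- by move=> t; rewrite flift_gen.
Qed.
End FreeGroupHom.

(** * The lower central series *)
Arguments lcs G q : simpl never.
Section LCS.
Variable G : groupType.
Implicit Types (A : set G) (x y : G).

Lemma is_subgroup1 A : is_subgroup A -> A 1. Proof. by case. Qed.
Lemma is_subgroupV A x : is_subgroup A -> A x -> A x^-1.
Proof. by move=> [A1 AD] Ax; rewrite -[x^-1]mul1g; apply: AD. Qed.
Lemma is_subgroupM A x y : is_subgroup A -> A x -> A y -> A (x * y).
Proof.
move=> sA Ax Ay; rewrite -[y]invgK; apply: sA.2 => //; exact: is_subgroupV.
Qed.

Lemma lcs_subgroup q : is_subgroup (lcs G q).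
Proof.
case: q => [|[|q]]; try by split.
split=> [B [sB _] | a b ha hb B sB]; first exact: sB.1.
by apply: sB.1.2; [apply: ha | apply: hb].
Qed.

Lemma lcs1 q : lcs G q 1. Proof. exact: (lcs_subgroup q).1. Qed.
Lemma lcsM q x y : lcs G q x -> lcs G q y -> lcs G q (x * y).
Proof. exact: (is_subgroupM (lcs_subgroup q)). Qed.
Lemma lcsV q x : lcs G q x -> lcs G q x^-1.
Proof. exact: (is_subgroupV (lcs_subgroup q)). Qed.

Lemma lcs_comm q x y : lcs G q.+1 y -> lcs G q.+2 [~ x, y].
Proof. by move=> hy B [_]; apply; exists x, y. Qed.

Lemma lcs_commV q x y : lcs G q.+1 x -> lcs G q.+2 [~ x, y].
Proof. by move=> hx; rewrite -invgR; apply: lcsV; apply: lcs_comm. Qed.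

Lemma lcs_ind q (P : set G) : is_subgroup P ->
  (forall x y, lcs G q.+1 y -> P [~ x, y]) -> forall x, lcs G q.+2 x -> P x.
Proof. by move=> sP PR x; apply; split=> // _ [a [b [hb ->]]]; apply: PR. Qed.

Lemma lcsS q x : lcs G q.+1 x -> lcs G q x.
Proof.
elim: q x => [|q IH] // x; case: q IH => [|q] IH //.
apply: (@lcs_ind q.+1 (lcs G q.+2)); first exact: lcs_subgroup.
by move=> a b /IH hb; apply: lcs_comm.
Qed.

Lemma lcsJ q x y : lcs G q x -> lcs G q (x ^ y).
Proof.
case: q => [|q] // hx.
have -> : x ^ y = x * [~ x, y] by gsimp.
by apply: lcsM => //; apply: lcsS; apply: lcs_commV.
Qed.
End LCS.

Lemma lcs_mult (G K : groupType) (f : G -> K) q x :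
  {morph f : x y / x * y} -> lcs G q x -> lcs K q (f x).
Proof.
move=> fM; elim: q x => [|[|q] IH] // x.
apply: (@lcs_ind _ q (fun x => lcs K q.+2 (f x))).
  split=> [|a b]; first by rewrite mult1 //; apply: lcs1.
  by move=> ha hb; rewrite fM multV //; apply: lcsM => //; apply: lcsV.
by move=> a b /IH hb; rewrite multR //; apply: lcs_comm.
Qed.

(** * Unitriangular representations *)

(** Unitriangular 4 by 4 integer matrices, by their entries above the diagonal. For
    the representation of a free group sending the generators into the first
    superdiagonal, the entries at distance 1, 2, 3 from the diagonal are the
    linear, quadratic and cubic coefficients of the Magnus expansion. *)
Record ut4 := UT4 { a12 : int; a23 : int; a34 : int; a13 : int; a24 : int; a14 : int }.
HB.instance Definition _ := gen_eqMixin ut4.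
HB.instance Definition _ := gen_choiceMixin ut4.

Section UT4Group.
Local Open Scope ring_scope.
Definition ut4_mul (A B : ut4) : ut4 :=
  UT4 (a12 A + a12 B) (a23 A + a23 B) (a34 A + a34 B)
    (a13 A + a12 A * a23 B + a13 B) (a24 A + a23 A * a34 B + a24 B)
    (a14 A + a12 A * a24 B + a13 A * a34 B + a14 B).
Definition ut4_one : ut4 := UT4 0 0 0 0 0 0.
Definition ut4_inv (A : ut4) : ut4 :=
  UT4 (- a12 A) (- a23 A) (- a34 A)
    (a12 A * a23 A - a13 A) (a23 A * a34 A - a24 A)
    (a12 A * a24 A + a13 A * a34 A - a12 A * a23 A * a34 A - a14 A).

Lemma ut4_ext A B : a12 A = a12 B -> a23 A = a23 B -> a34 A = a34 B ->
  a13 A = a13 B -> a24 A = a24 B -> a14 A = a14 B -> A = B.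
Proof. by case: A; case: B => /= ? ? ? ? ? ? ? ? ? ? ? ? -> -> -> -> -> ->. Qed.

Lemma ut4_mulA : associative ut4_mul.
Proof. by move=> A B C; apply: ut4_ext => /=; ring. Qed.
Lemma ut4_mul1 : left_id ut4_one ut4_mul.
Proof. by move=> A; apply: ut4_ext => /=; ring. Qed.
Lemma ut4_mulr1 : right_id ut4_one ut4_mul.
Proof. by move=> A; apply: ut4_ext => /=; ring. Qed.
Lemma ut4_mulV : left_inverse ut4_one ut4_inv ut4_mul.
Proof. by move=> A; apply: ut4_ext => /=; ring. Qed.
Lemma ut4_mulVr : right_inverse ut4_one ut4_inv ut4_mul.
Proof. by move=> A; apply: ut4_ext => /=; ring. Qed.
HB.instance Definition _ :=
  isGroup.Build ut4 ut4_mulA ut4_mul1 ut4_mulr1 ut4_mulV ut4_mulVr.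

Lemma ut4_mulE (A B : ut4) : (A * B)%g = ut4_mul A B. Proof. by []. Qed.
End UT4Group.

Arguments ut4_mul : simpl never.

Section UT4Hom.
Local Open Scope ring_scope.
Variables (G : groupType) (r : G -> ut4).
Hypothesis rM : {morph r : x y / (x * y)%g}.

Lemma ut4_diag_comm A B :
  [/\ a12 [~ A, B]%g = 0, a23 [~ A, B]%g = 0 & a34 [~ A, B]%g = 0].
Proof. by rewrite commgEl conjgE !ut4_mulE; split; rewrite /=; ring. Qed.

Lemma ut4_lcs2 c : lcs G 2 c -> [/\ a12 (r c) = 0, a23 (r c) = 0 & a34 (r c) = 0].
Proof.
apply: (@lcs_ind G 0 (fun c => [/\ a12 (r c) = 0, a23 (r c) = 0 & a34 (r c) = 0])).
  split=> [|a b]; first by rewrite mult1.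
  move=> [e1 e2 e3] [e4 e5 e6]; rewrite rM multV // ut4_mulE /=.
  by rewrite e1 e2 e3 e4 e5 e6; split; ring.
by move=> x y _; rewrite multR //; apply: ut4_diag_comm.
Qed.

Lemma ut4_lcs3 c : lcs G 3 c -> a13 (r c) = 0 /\ a24 (r c) = 0.
Proof.
move=> hc.
suff [] : lcs G 2 c /\ (a13 (r c) = 0 /\ a24 (r c) = 0) by [].
move: c hc; apply: (@lcs_ind G 1 (fun c => lcs G 2 c /\ (a13 (r c) = 0 /\ a24 (r c) = 0))).
  split=> [|a b]; first by rewrite mult1 //; split=> //; apply: lcs1.
  move=> [ha [e1 e2]] [hb [e3 e4]]; split; first exact: (lcs_subgroup G 2).2.
  have [a1 a2 a3] := ut4_lcs2 ha; have [b1 b2 b3] := ut4_lcs2 hb.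
  by rewrite rM multV // ut4_mulE /= a1 a2 b1 b2 b3 e1 e2 e3 e4; split; ring.
move=> x y hy; split; first exact: lcs_comm.
have [a1 a2 a3] := ut4_lcs2 hy.
by rewrite multR // commgEl conjgE !ut4_mulE /= a1 a2 a3; split; ring.
Qed.

End UT4Hom.

(** On commutators the quadratic entry is a polynomial in the linear ones; hence the
    choice of the quadratic entries on generators does not matter on [G_2]. *)
Lemma ut4_lcs2_eq (G : groupType) (r r' : G -> ut4) (c : G) :
  {morph r : x y / (x * y)%g} -> {morph r' : x y / (x * y)%g} ->
  (forall x, a12 (r x) = a12 (r' x)) -> (forall x, a23 (r x) = a23 (r' x)) ->
  lcs G 2 c -> a13 (r c) = a13 (r' c).
Proof.
move=> rM r'M e12 e23 hc.
suff [] : lcs G 2 c /\ a13 (r c) = a13 (r' c) by [].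
move: c hc; apply: (@lcs_ind G 0 (fun c => lcs G 2 c /\ a13 (r c) = a13 (r' c))).
  split=> [|a b]; first by rewrite !mult1 //; split=> //; apply: lcs1.
  move=> [ha ea] [hb eb]; split; first exact: (lcs_subgroup G 2).2.
  rewrite rM r'M !(multV rM) !(multV r'M) !ut4_mulE /= ea eb.
  by rewrite !e12 !e23.
move=> x y hy; split; first exact: lcs_comm.
rewrite (multR rM) (multR r'M) !commgEl !conjgE !ut4_mulE /= !e12 !e23; ring.
Qed.

(** * Linear and quadratic coefficients *)

Section Coefficients.
Variable T : choiceType.
Local Open Scope ring_scope.
Implicit Types (phi psi chi : T -> int) (w x y : fgroup T).

Definition rho phi psi chi : fgroup T -> ut4 :=
  flift (fun t => UT4 (phi t) (psi t) (chi t) 0 0 0).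

Lemma rhoM phi psi chi : {morph rho phi psi chi : x y / (x * y)%g}.
Proof. exact: flift_morph. Qed.
Lemma rho_gen phi psi chi t :
  rho phi psi chi (fgen t) = UT4 (phi t) (psi t) (chi t) 0 0 0.
Proof. exact: flift_gen. Qed.

(** [e1 phi] is the homomorphism to the integers extending [phi], and
    [e2 phi psi] is the quadratic Magnus coefficient paired with [phi (x) psi]. *)
Definition e1 phi w : int := a12 (rho phi (fun=> 0) (fun=> 0) w).
Definition e2 phi psi w : int := a13 (rho phi psi (fun=> 0) w).

Lemma rho_diag phi psi chi w :
  [/\ a12 (rho phi psi chi w) = e1 phi w, a23 (rho phi psi chi w) = e1 psi w
    & a34 (rho phi psi chi w) = e1 chi w].
Proof.
rewrite /e1; elim/fgroup_gen_ind: w => [|t|t|u w [h1 h2 h3] [k1 k2 k3]].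
- by rewrite !mult1 //; apply: rhoM.
- by rewrite !rho_gen.
- by rewrite !multV ?rho_gen //; apply: rhoM.
- by rewrite !rhoM !ut4_mulE /= h1 h2 h3 k1 k2 k3.
Qed.

Lemma rho_up phi psi chi w :
  a13 (rho phi psi chi w) = e2 phi psi w /\ a24 (rho phi psi chi w) = e2 psi chi w.
Proof.
rewrite /e2; elim/fgroup_gen_ind: w => [|t|t|u w [h1 h2] [k1 k2]].
- by rewrite !mult1 //; apply: rhoM.
- by rewrite !rho_gen.
- by rewrite !multV ?rho_gen //; apply: rhoM.
rewrite !rhoM !ut4_mulE /= h1 h2 k1 k2.
have [-> -> _] := rho_diag phi psi chi u.
have [_ -> ->] := rho_diag phi psi chi w.
have [-> _ _] := rho_diag phi psi (fun=> 0) u.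
have [_ -> _] := rho_diag phi psi (fun=> 0) w.
have [-> _ _] := rho_diag psi chi (fun=> 0) u.
by have [_ -> _] := rho_diag psi chi (fun=> 0) w.
Qed.

Lemma e1_gen phi t : e1 phi (fgen t) = phi t.
Proof. by rewrite /e1 rho_gen. Qed.
Lemma e1_1 phi : e1 phi 1%g = 0.
Proof. by rewrite /e1 mult1 //; apply: rhoM. Qed.
Lemma e1M phi x y : e1 phi (x * y)%g = e1 phi x + e1 phi y.
Proof. by rewrite /e1 rhoM. Qed.
Lemma e1V phi x : e1 phi (x^-1)%g = - e1 phi x.
Proof. by rewrite /e1 multV //; apply: rhoM. Qed.
Lemma e1J phi x y : e1 phi (x ^ y)%g = e1 phi x.
Proof. by rewrite conjgE !e1M e1V addrCA addNr addr0. Qed.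
Lemma e1R phi x y : e1 phi [~ x, y]%g = 0.
Proof. by rewrite commgEl e1M e1J e1V addNr. Qed.

Lemma e1_uniq (f : fgroup T -> int) : (forall x y, f (x * y)%g = f x + f y) ->
  forall w, f w = e1 (fun t => f (fgen t)) w.
Proof.
move=> fM; have f1 : f 1%g = 0 by apply: (addrI (f 1%g)); rewrite -fM mulg1 addr0.
have fV x : f (x^-1)%g = - f x by apply: (addrI (f x)); rewrite -fM mulgV subrr.
apply: fgroup_gen_ind => [|t|t|u w].
- by rewrite e1_1.
- by rewrite e1_gen.
- by rewrite fV e1V e1_gen.
- by rewrite fM e1M => -> ->.
Qed.

Lemma e2_1 phi psi : e2 phi psi 1%g = 0.
Proof. by rewrite /e2 mult1 //; apply: rhoM. Qed.
Lemma e2M phi psi x y :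
  e2 phi psi (x * y)%g = e2 phi psi x + e1 phi x * e1 psi y + e2 phi psi y.
Proof.
rewrite /e2 rhoM ut4_mulE /=.
by have [-> _ _] := rho_diag phi psi (fun=> 0) x; have [_ -> _] := rho_diag phi psi (fun=> 0) y.
Qed.
Lemma e2V phi psi x : e2 phi psi (x^-1)%g = e1 phi x * e1 psi x - e2 phi psi x.
Proof.
rewrite /e2 multV /=; last exact: rhoM.
by have [-> -> _] := rho_diag phi psi (fun=> 0) x.
Qed.
Lemma e2R phi psi x y :
  e2 phi psi [~ x, y]%g = e1 phi x * e1 psi y - e1 phi y * e1 psi x.
Proof. by rewrite commgEl conjgE !(e2M, e2V, e1M, e1V); ring. Qed.

Lemma e1_lcs2 phi w : lcs _ 2 w -> e1 phi w = 0.
Proof. by move=> h; have [] := ut4_lcs2 (rhoM phi (fun=> 0) (fun=> 0)) h. Qed.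
Lemma e2_lcs3 phi psi w : lcs _ 3 w -> e2 phi psi w = 0.
Proof. by move=> h; have [] := ut4_lcs3 (rhoM phi psi (fun=> 0)) h. Qed.
End Coefficients.

Lemma e1_comp (S T : choiceType) (f : fgroup S -> fgroup T) phi w :
  {morph f : x y / x * y} -> e1 phi (f w) = e1 (fun s => e1 phi (f (fgen s))) w.
Proof.
by move=> fM; apply: (e1_uniq (f := fun w => e1 phi (f w))) => x y; rewrite fM e1M.
Qed.

(** Naturality holds only on [F_2]: in general the quadratic coefficients of
    [f (fgen s)] itself would contribute. *)
Lemma e2_comp (S T : choiceType) (f : fgroup S -> fgroup T) phi psi c :
  {morph f : x y / x * y} -> lcs _ 2 c ->
  e2 phi psi (f c) = e2 (fun s => e1 phi (f (fgen s))) (fun s => e1 psi (f (fgen s))) c.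
Proof.
move=> fM; apply: (@ut4_lcs2_eq _ (rho phi psi (fun=> 0%R) \o f)).
- by move=> x y; rewrite /= fM rhoM.
- exact: rhoM.
- move=> x /=; have [-> _ _] := rho_diag phi psi (fun=> 0%R) (f x).
  by have [-> _ _] := rho_diag (fun s => e1 phi (f (fgen s)))
    (fun s => e1 psi (f (fgen s))) (fun=> 0%R) x; apply: e1_comp.
- move=> x /=; have [_ -> _] := rho_diag phi psi (fun=> 0%R) (f x).
  by have [_ -> _] := rho_diag (fun s => e1 phi (f (fgen s)))
    (fun s => e1 psi (f (fgen s))) (fun=> 0%R) x; apply: e1_comp.
Qed.

(** * Detecting the lower central series by coefficients *)

Section EqMod.
Variables (G : groupType) (q : nat).
Local Notation "x == y" := (eq_mod (lcs G q) x y).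
Implicit Types x y z : G.

Lemma eqm_refl x : x == x.
Proof. by rewrite /eq_mod mulVg; apply: lcs1. Qed.
Lemma eqm_sym x y : x == y -> y == x.
Proof. by move=> /lcsV; rewrite invgM invgK. Qed.
Lemma eqm_trans x y z : x == y -> y == z -> x == z.
Proof. by move=> h /(lcsM h); rewrite mulgA mulgK. Qed.
Lemma eqmM x x' y y' : x == x' -> y == y' -> x * y == x' * y'.
Proof.
move=> hx /(lcsM (lcsJ y hx)); rewrite /eq_mod; congr (lcs _ _ _).
by gsimp.
Qed.
Lemma eqmV x y : x == y -> x^-1 == y^-1.
Proof.
move=> /eqm_sym/(lcsJ y^-1); rewrite /eq_mod; congr (lcs _ _ _).
by gsimp.
Qed.
Lemma eqm_lcs x y : x == y -> lcs G q x -> lcs G q y.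
Proof. by move=> h hx; rewrite -[y](mulVKg x); apply: lcsM. Qed.
End EqMod.

Lemma eqmS (G : groupType) q (x y : G) :
  eq_mod (lcs G q.+1) x y -> eq_mod (lcs G q) x y.
Proof. exact: lcsS. Qed.

(** The combinatorial core of both detection lemmas. Modulo the next term of the
    series the values [v a] commute, so a letter can be cancelled against its
    opposite anywhere in the product. If no opposite of the first letter occurs, all
    contributions to its coefficient are nonnegative and the first one is positive,
    so that the coefficient does not vanish. *)
Section CancelLetters.
Local Open Scope ring_scope.
Variables (G : groupType) (A : eqType) (v : A -> G) (opp : A -> A) (q : nat).
Variable coef : A -> A -> int.
Hypothesis v_lcs : forall a, lcs G q.+1 (v a).
Hypothesis v_opp : forall a, v (opp a) = ((v a)^-1)%g.
Hypothesis coef_opp : forall a b, coef a (opp b) = - coef a b.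
Hypothesis coef_neg : forall a b, coef a b < 0 -> b = opp a.
Hypothesis coef_diag : forall a, 0 < coef a a \/ (v a = 1%g /\ forall b, coef b a = 0).

Lemma cancel_letters (l : seq A) :
  (forall a, \sum_(b <- l) coef a b = 0) -> lcs G q.+2 (\prod_(b <- l) v b)%g.
Proof.
have [n] := ubnP (size l); elim: n l => // n IH [|a l] /=.
  by move=> _ _; rewrite big_nil; apply: lcs1.
rewrite ltnS => sl h; case: (coef_diag a) => [pos|[va1 a0]]; last first.
  rewrite big_cons va1 mul1g; apply: IH => // b.
  by have := h b; rewrite big_cons a0 add0r.
have : opp a \in l.
  apply/negPn/negP => nl; have := h a; rewrite big_cons => e.
  suff s0 : 0 <= \sum_(b <- l) coef a b by have := ltr_wpDr s0 pos; rewrite e ltxx.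
  rewrite big_seq; apply: sumr_ge0 => b bl; rewrite leNgt.
  by apply/negP => /coef_neg eb; rewrite -eb bl in nl.
move=> /splitPr sl'; case: sl' sl h => l1 l2 sl h.
have -> : (\prod_(b <- a :: l1 ++ opp a :: l2) v b =
   [~ (v a)^-1, (\prod_(b <- l1) v b)^-1] * \prod_(b <- l1 ++ l2) v b)%g.
  by rewrite big_cons !big_cat big_cons /= v_opp; gsimp.
apply: lcsM; first by apply: lcs_commV; apply: lcsV.
apply: IH; first by move: sl; rewrite !size_cat /=; lia.
move=> b; have := h b; rewrite big_cons !big_cat big_cons /= coef_opp.
by rewrite addrCA addNKr.
Qed.
End CancelLetters.

Section Detection.
Variable T : choiceType.
Local Open Scope ring_scope.
Implicit Types (w x y : fgroup T).

Definition dual (t : T) : T -> int := fun s => (s == t)%:R.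

Lemma lcs2_detect w : (forall t, e1 (dual t) w = 0) -> lcs _ 2 w.
Proof.
move=> h; rewrite (fgroup_letters w).
pose sg (b : bool) : int := if b then 1 else -1.
have valE t a : e1 (dual t) (letter_val a) = (a.1 == t)%:R * sg a.2.
  by case: a => s [] /=; rewrite /letter_val /lval /sg /= ?e1V e1_gen ?mulr1 ?mulrN1.
pose coef (a b : T * bool) : int := sg a.2 * e1 (dual a.1) (letter_val b).
apply: (@cancel_letters _ _ (@letter_val T) (@linv T) 0 coef) => //.
- by move=> a; rewrite /letter_val lval_linv.
- by move=> a b; rewrite /coef /letter_val lval_linv e1V mulrN.
- move=> [s a] [t b]; rewrite /coef valE /=; case: eqP => [->|_]; last first.
    by rewrite mul0r mulr0.
  by case: a; case: b.
- by move=> [s a]; left; rewrite /coef valE eqxx; case: a.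
move=> a; rewrite /coef -mulr_sumr.
have -> : \sum_(i <- fword w) e1 (dual a.1) (letter_val i) = e1 (dual a.1) w.
  rewrite [in RHS](fgroup_letters w); symmetry.
  by apply: (big_morph (e1 (dual a.1)) (e1M _) (e1_1 _)).
by rewrite h mulr0.
Qed.

Definition basic_comm (p : T * T) : fgroup T := [~ fgen p.1, fgen p.2]%g.

Local Notation "x =3 y" := (eq_mod (lcs (fgroup T) 3) x y) (at level 70).

Lemma comm_mul_l x y z : [~ x * y, z]%g =3 ([~ x, z] * [~ y, z])%g.
Proof.
have -> : ([~ x * y, z] = [~ x, z] ^ y * [~ y, z])%g by gsimp.
apply: eqmM; last exact: eqm_refl.
apply: eqm_sym; rewrite /eq_mod -commgEl; apply: lcs_commV; exact: lcs_comm.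
Qed.
Lemma comm_inv_l x z : [~ x^-1, z]%g =3 ([~ x, z]^-1)%g.
Proof.
have -> : ([~ x^-1, z] = ([~ x, z]^-1) ^ x^-1)%g by gsimp.
apply: eqm_sym; rewrite /eq_mod -commgEl; apply: lcs_commV; apply: lcsV.
exact: lcs_comm.
Qed.

(** Since [[s, t]^-1 = [t, s]], products of basic commutators already form a group
    modulo [F_3], and no exponents are needed. *)
Definition basic_prod w := exists l : seq (T * T), w =3 (\prod_(p <- l) basic_comm p)%g.

Lemma basic_prod_eqm x y : x =3 y -> basic_prod x -> basic_prod y.
Proof. by move=> h [l hl]; exists l; apply: eqm_trans hl; apply: eqm_sym. Qed.

Lemma basic_prod_subgroup : is_subgroup basic_prod.
Proof.
split=> [|x y [lx hx] [ly hy]]; first by exists [::]; rewrite big_nil; apply: eqm_refl.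
exists (lx ++ rev [seq (p.2, p.1) | p <- ly]); rewrite big_cat; apply: eqmM => //=.
apply: eqm_trans (eqmV hy) _.
suff -> : (\prod_(p <- rev [seq (p.2, p.1) | p <- ly]) basic_comm p =
    (\prod_(p <- ly) basic_comm p)^-1)%g by exact: eqm_refl.
rewrite -map_rev big_map -[ly in RHS]revK -prodgV; apply: eq_bigr => p _.
by rewrite /basic_comm invgR.
Qed.

Lemma basic_prod_comm x y : basic_prod [~ x, y]%g.
Proof.
have sB := basic_prod_subgroup.
have gen s : basic_prod [~ fgen s, y]%g.
  rewrite -invgR; apply: is_subgroupV => //.
  elim/fgroup_gen_ind: y => [|t|t|u w hu hw].
  - by rewrite comm1g; apply: is_subgroup1.
  - by exists [:: (t, s)]; rewrite big_seq1; apply: eqm_refl.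
  - apply: basic_prod_eqm (eqm_sym (comm_inv_l _ _)) _; apply: is_subgroupV => //.
    by exists [:: (t, s)]; rewrite big_seq1; apply: eqm_refl.
  - by apply: basic_prod_eqm (eqm_sym (comm_mul_l _ _ _)) _; apply: is_subgroupM.
elim/fgroup_gen_ind: x => [|s|s|u w hu hw] //.
- by rewrite comm1g; apply: is_subgroup1.
- by apply: basic_prod_eqm (eqm_sym (comm_inv_l _ _)) _; apply: is_subgroupV.
- by apply: basic_prod_eqm (eqm_sym (comm_mul_l _ _ _)) _; apply: is_subgroupM.
Qed.

Lemma basic_prod_lcs2 w : lcs _ 2 w -> basic_prod w.
Proof.
apply: lcs_ind; first exact: basic_prod_subgroup.
by move=> x y _; apply: basic_prod_comm.
Qed.

(** Modulo [F_3] a word of [F_2] is a product of commutators of generators, and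
    these are the letters to cancel: the opposite of [[s, t]] is [[t, s]]. *)
Lemma lcs3_detect w : lcs _ 2 w -> (forall s t, e2 (dual s) (dual t) w = 0) -> lcs _ 3 w.
Proof.
move=> /basic_prod_lcs2 [l hl] h; apply: (eqm_lcs (eqm_sym hl)).
pose coef (a b : T * T) : int := e2 (dual a.1) (dual a.2) (basic_comm b).
have coefE a b : coef a b = (b.1 == a.1)%:R * (b.2 == a.2)%:R - (b.2 == a.1)%:R * (b.1 == a.2)%:R.
  by rewrite /coef e2R !e1_gen.
apply: (@cancel_letters _ _ basic_comm (fun p => (p.2, p.1)) 1 coef).
- by move=> a; apply: lcs_comm.
- by move=> a; rewrite /basic_comm -invgR.
- by move=> a b; rewrite !coefE /=; ring.
- move=> [s t] [s' t']; rewrite coefE /=.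
  by do ![case: eqP => [->|?] /=].
- move=> [s t]; have [->|ne] := eqVneq s t.
    right; split; first exact: commgg.
    by move=> [s' t']; rewrite coefE /=; ring.
  by left; rewrite coefE /= !eqxx [t == s]eq_sym (negPf ne).
move=> [s t] /=.
have cM : forall l : seq (T * T), lcs _ 2 (\prod_(p <- l) basic_comm p)%g /\
    \sum_(b <- l) coef (s, t) b = e2 (dual s) (dual t) (\prod_(p <- l) basic_comm p)%g.
  elim=> [|p m [h2 IH]]; first by rewrite !big_nil e2_1; split=> //; apply: lcs1.
  rewrite !big_cons; split; first by apply: lcsM => //; apply: lcs_comm.
  by rewrite e2M e1R mul0r addr0 IH.
rewrite (cM l).2; have := e2_lcs3 (dual s) (dual t) hl; rewrite e2M e2V e1V h.
rewrite (e1_lcs2 (dual s)); last first.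
  by apply: (eqm_lcs (eqm_sym (eqmS hl))); case: (cM l).
by rewrite !(mul0r, oppr0, subr0, add0r, addr0).
Qed.
End Detection.

(** * The intersection form *)
Section Surface.
Variable g : nat.
Local Notation I := ('I_g + 'I_g)%type.
Local Notation F := (Fsurf g).
Local Notation x := (@xgen g).
Local Notation y := (@ygen g).
Implicit Types (phi psi chi : I -> int) (z u w : F).

Definition handle (j : 'I_g) : F := [~ x j, y j].
Definition bdry_seq (s : seq 'I_g) : F := \prod_(j <- s) handle j.

Lemma bdryE : bdry g = bdry_seq (index_enum 'I_g).
Proof. by []. Qed.

Local Open Scope ring_scope.

Lemma e_bdry_seq phi psi s : e1 phi (bdry_seq s) = 0 /\
  e2 phi psi (bdry_seq s) =
    \sum_(j <- s) (phi (inl j) * psi (inr j) - phi (inr j) * psi (inl j)).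
Proof.
elim: s => [|j s [h1 h2]]; rewrite /bdry_seq ?big_nil ?e1_1 ?e2_1 // !big_cons.
by rewrite /handle e1M e2M !e1R e2R !e1_gen h1 h2 mul0r add0r addr0.
Qed.

(** The intersection pairing of [z] with [u] is [e1 (om z) u]. *)
Definition om z : I -> int := fun s =>
  match s with inl j => - e1 (dual (inr j)) z | inr j => e1 (dual (inl j)) z end.

Lemma e2_bdry phi psi : e2 phi psi (bdry g) =
    \sum_j (phi (inl j) * psi (inr j) - phi (inr j) * psi (inl j)).
Proof. by rewrite bdryE (e_bdry_seq phi psi _).2. Qed.

(** The boundary word represents the tensor of the intersection form, so that pairing it
    with [om z] recovers [z] up to sign. *)
Lemma om_bdry z psi : e2 (om z) psi (bdry g) = - e1 psi z.
Proof.
apply: oppr_inj; rewrite opprK; pose f w := - e2 (om w) psi (bdry g).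
have fM u w : f (u * w)%g = f u + f w.
  rewrite /f !e2_bdry -!sumrN -big_split; apply: eq_bigr => j _ /=.
  by rewrite !e1M; ring.
rewrite -/(f z) (e1_uniq fM); congr (e1 _ z); apply: funext => s.
rewrite /f e2_bdry -sumrN; case: s => k; rewrite (bigD1 k) //= big1 => [|j /negPf jk].
- by rewrite !e1_gen /dual /= eqxx ?mulr1n; ring.
- by rewrite !e1_gen /dual /= !(inj_eq (@inl_inj _ _)) [k == j]eq_sym jk ?mulr0n; ring.
- by rewrite !e1_gen /dual /= eqxx ?mulr1n; ring.
- by rewrite !e1_gen /dual /= !(inj_eq (@inr_inj _ _)) [k == j]eq_sym jk ?mulr0n; ring.
Qed.

Lemma bdry_nondeg phi phi' :
  (forall psi, e2 phi psi (bdry g) = e2 phi' psi (bdry g)) -> phi =1 phi'.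
Proof.
have key f s : e2 f (dual s) (bdry g) =
    match s with inl j => - f (inr j) | inr j => f (inl j) end.
  rewrite e2_bdry; case: s => k; rewrite (bigD1 k) //= big1 => [|j /negPf jk].
  - by rewrite /dual /= eqxx ?mulr1n; ring.
  - by rewrite /dual /= !(inj_eq (@inl_inj _ _)) jk ?mulr0n; ring.
  - by rewrite /dual /= eqxx ?mulr1n; ring.
  - by rewrite /dual /= !(inj_eq (@inr_inj _ _)) jk ?mulr0n; ring.
move=> h [] j; first by have := h (dual (inr j)); rewrite !key.
by have := h (dual (inl j)); rewrite !key => /oppr_inj.
Qed.

Lemma bdry_lcs2 : lcs F 2 (bdry g).
Proof.
by apply: lcs2_detect => t; rewrite bdryE (e_bdry_seq _ (dual t) _).1.
Qed.

Definition sympl (f : F -> F) := forall z u, e1 (om (f z)) (f u) = e1 (om z) u.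

Definition homology_id (f : F -> F) := forall phi z, e1 phi (f z) = e1 phi z.

Lemma om_homology z w : (forall phi, e1 phi z = e1 phi w) -> om z = om w.
Proof. by move=> h; apply: funext => -[] j /=; rewrite h. Qed.

Lemma homology_id_sympl f : homology_id f -> sympl f.
Proof. by move=> hf z u; rewrite hf (om_homology (w := z)). Qed.

(** The functional [om (f z) \o f] is determined by its pairings with the
    boundary word, and [f] fixes that word: by [om_bdry] both [om (f z) \o f] and
    [om z] give [- e1 psi z] when paired with [psi]. *)
Lemma bdry_sympl (f f' : F -> F) :
  {morph f : u w / (u * w)%g} -> {morph f' : u w / (u * w)%g} ->
  cancel f f' -> cancel f' f -> f (bdry g) = bdry g -> sympl f.
Proof.
move=> fM f'M ff' f'f fb z u; rewrite (e1_comp _ _ fM); congr (e1 _ u).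
apply: funext; apply: bdry_nondeg => psi.
have -> : psi = (fun s => e1 (fun s => e1 psi (f' (fgen s))) (f (fgen s))).
  by apply: funext => s; rewrite -(e1_comp _ _ f'M) ff' e1_gen.
rewrite -e2_comp //; last exact: bdry_lcs2.
by rewrite fb !om_bdry; congr (- _); rewrite -!e1_comp // ff'.
Qed.

(** * Automorphisms that extend to the handlebody *)

(** An automorphism with its inverse, both preserving the kernel of [i_star]; it need
    not fix the boundary word. *)

Record haut (f f' : F -> F) : Prop := Haut {
  hautM : {morph f : u w / (u * w)%g};
  hautM' : {morph f' : u w / (u * w)%g};
  hautK : cancel f f';
  hautK' : cancel f' f;
  haut_x : forall j, i_star (f (x j)) = 1%g;
  haut_x' : forall j, i_star (f' (x j)) = 1%g }.

Lemma haut_sym f f' : haut f f' -> haut f' f.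
Proof. by case=> *; split. Qed.

Lemma i_starM : {morph @i_star g : u w / (u * w)%g}.
Proof. exact: flift_morph. Qed.

(** The kernel of [i_star] is the normal closure of the [x_j], and [i_star] is split
    by [y_j |-> y_j]. *)
Lemma i_star_factor (f : F -> F) : {morph f : u w / (u * w)%g} ->
  (forall j, i_star (f (x j)) = 1%g) ->
  exists2 fbar : Fhand g -> Fhand g, {morph fbar : u w / (u * w)%g} &
    forall w, i_star (f w) = fbar (i_star w).
Proof.
move=> fM fx; pose sec : Fhand g -> F := flift (fun j => y j).
have secM : {morph sec : u w / (u * w)%g} by exact: flift_morph.
exists (fun v : Fhand g => i_star (f (sec v))) => [u w|].
  by rewrite secM fM i_starM.
apply: eq_mult => [u w|u w|[] j].
- by rewrite fM i_starM.
- by rewrite i_starM secM fM i_starM.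
- by rewrite [i_star (fgen _)]flift_gen (mult1 secM) (mult1 fM) (mult1 i_starM) fx.
- by rewrite [i_star (fgen _)]flift_gen [sec (fgen _)]flift_gen.
Qed.

Lemma i_star_ker (f : F -> F) w : {morph f : u w / (u * w)%g} ->
  (forall j, i_star (f (x j)) = 1%g) -> i_star w = 1%g -> i_star (f w) = 1%g.
Proof.
by move=> fM fx; have [fb fbM ->] := i_star_factor fM fx => ->; rewrite mult1.
Qed.

Lemma haut_comp b b' f f' : haut b b' -> haut f f' ->
  haut (fun w => b (f w)) (fun w => f' (b' w)).
Proof.
case=> bM b'M bK b'K bx b'x [fM f'M fK f'K fx f'x]; split.
- by move=> u w; rewrite fM bM.
- by move=> u w; rewrite b'M f'M.
- by move=> w; rewrite bK fK.
- by move=> w; rewrite f'K b'K.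
- by move=> j; apply: i_star_ker.
- by move=> j; apply: i_star_ker.
Qed.

Lemma haut_id : haut id id.
Proof. by split=> // j; rewrite [LHS]flift_gen. Qed.

(** * The Johnson homomorphism *)

Lemma homology_id_lcs2 f z : homology_id f -> lcs F 2 (z^-1 * f z)%g.
Proof. by move=> h; apply: lcs2_detect => t; rewrite e1M e1V h addNr. Qed.

Lemma homology_id_comp f f' : homology_id f -> homology_id f' ->
  homology_id (fun w => f (f' w)).
Proof. by move=> h h' phi z; rewrite h h'. Qed.

Lemma homology_id_inv f f' : cancel f' f -> homology_id f -> homology_id f'.
Proof. by move=> f'K h phi z; rewrite -h f'K. Qed.

(** The first Johnson homomorphism of [f], in coordinates. *)
Definition kappa (f : F -> F) phi psi z := e2 phi psi (z^-1 * f z)%g.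

Lemma e2_lcs2M phi psi c d : lcs F 2 c ->
  e2 phi psi (c * d)%g = e2 phi psi c + e2 phi psi d.
Proof. by move=> h; rewrite e2M (e1_lcs2 phi h) mul0r addr0. Qed.

Lemma e2J_lcs2 phi psi c w : lcs F 2 c -> e2 phi psi (c ^ w)%g = e2 phi psi c.
Proof.
move=> hc; have -> : (c ^ w = c * [~ c, w])%g by rewrite commgEl mulVKg.
by rewrite e2_lcs2M // (e2_lcs3 _ _ (lcs_commV w hc)) addr0.
Qed.

Lemma e2_homology_id f phi psi c : {morph f : u w / (u * w)%g} -> homology_id f ->
  lcs F 2 c -> e2 phi psi (f c) = e2 phi psi c.
Proof.
move=> fM h hc; rewrite e2_comp //; congr (e2 _ _ c);
  by apply: funext => s; rewrite h e1_gen.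
Qed.

Lemma kappa_comp f f' phi psi z : {morph f : u w / (u * w)%g} ->
  homology_id f -> homology_id f' ->
  kappa (fun w => f (f' w)) phi psi z = kappa f phi psi z + kappa f' phi psi z.
Proof.
move=> fM h h'; rewrite /kappa.
have -> : (z^-1 * f (f' z) = (z^-1 * f z) * f (z^-1 * f' z))%g.
  by rewrite fM (multV fM) mulgA mulgK.
rewrite e2_lcs2M; last exact: homology_id_lcs2.
by rewrite (e2_homology_id _ _ fM h) //; apply: homology_id_lcs2.
Qed.

Lemma kappaM f phi psi z w : {morph f : u w / (u * w)%g} -> homology_id f ->
  kappa f phi psi (z * w)%g = kappa f phi psi z + kappa f phi psi w.
Proof.
move=> fM h; rewrite /kappa.
have hz := homology_id_lcs2 z h.
have -> : ((z * w)^-1 * f (z * w) = (z^-1 * f z) * [~ z^-1 * f z, w] * (w^-1 * f w))%g.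
  by rewrite fM commgEl conjgE !invgM !mulgA !(mulgK, mulgV, mulVg, mul1g, invgK, mulgVK).
have hc := lcs_commV w hz.
rewrite e2_lcs2M; last by apply: lcsM => //; apply: lcsS.
by rewrite e2_lcs2M // (e2_lcs3 _ _ hc) addr0.
Qed.

(** The first argument of [tau] is the functional that [z] defines through the
    intersection form, so that [tau] is a trilinear form on the dual of [H]. *)
Definition realizes (f : F -> F) (tau : (I -> int) -> (I -> int) -> (I -> int) -> int) :=
  homology_id f /\ forall z phi psi, kappa f phi psi z = tau (om z) phi psi.

(** The tensor [U /\ V /\ W], evaluated at three functionals. Taking [U], [V], [W] in
    [F] rather than in [H] makes the action of an automorphism on it plain
    application. *)
Definition hdet (U V W : F) chi phi psi : int :=
  e1 chi U * (e1 phi V * e1 psi W - e1 phi W * e1 psi V)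
  - e1 chi V * (e1 phi U * e1 psi W - e1 phi W * e1 psi U)
  + e1 chi W * (e1 phi U * e1 psi V - e1 phi V * e1 psi U).

(** Equivariance of the Johnson homomorphism, for a symplectic [b] that may move the
    boundary word: this allows reorderings of the handles as [b]. *)
Lemma realizes_conj b b' f f' U V W : haut b b' -> haut f f' -> sympl b ->
  realizes f (hdet U V W) ->
  realizes (fun w => b (f (b' w))) (hdet (b U) (b V) (b W)).
Proof.
move=> [bM b'M bK b'K _ _] [fM _ _ _ _ _] sb [fh fk]; split=> [phi z|z phi psi].
  by rewrite (e1_comp _ _ bM) fh -(e1_comp _ _ bM) b'K.
rewrite /kappa.
have -> : (z^-1 * b (f (b' z)) = b ((b' z)^-1 * f (b' z)))%g.
  by rewrite bM (multV bM) b'K.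
rewrite e2_comp //; last exact: homology_id_lcs2.
rewrite -/(kappa _ _ _ _) fk /hdet -!(e1_comp _ _ bM).
by rewrite -!(sb (b' z)) b'K.
Qed.

(** The tensors of handlebody classes in the Torelli group; they form a group. *)
Definition realizable tau := exists f f',
  [/\ haut f f', f (bdry g) = bdry g & realizes f tau].

Lemma realizable_ext tau tau' : (forall chi phi psi, tau chi phi psi = tau' chi phi psi) ->
  realizable tau -> realizable tau'.
Proof.
by move=> e [f [f' [hf fb [fh fk]]]]; exists f, f'; split=> //; split=> // *; rewrite -e fk.
Qed.

Lemma realizable0 : realizable (fun _ _ _ => 0).
Proof.
exists id, id; split=> //; first exact: haut_id.
by split=> // z phi psi; rewrite /kappa mulVg e2_1.
Qed.

Lemma realizableD tau tau' : realizable tau -> realizable tau' ->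
  realizable (fun chi phi psi => tau chi phi psi + tau' chi phi psi).
Proof.
move=> [f [f' [hf fb [fh fk]]]] [k [k' [hk kb [kh kk]]]].
exists (fun w => f (k w)), (fun w => k' (f' w)); split.
- exact: haut_comp.
- by rewrite kb fb.
split=> [|z phi psi]; first exact: homology_id_comp.
by rewrite kappa_comp ?fk ?kk //; case: hf.
Qed.

Lemma realizableN tau : realizable tau ->
  realizable (fun chi phi psi => - tau chi phi psi).
Proof.
move=> [f [f' [hf fb [fh fk]]]]; exists f', f; split; first exact: haut_sym.
  by rewrite -[in LHS]fb (hautK hf).
have fh' := homology_id_inv (hautK' hf) fh.
split=> // z phi psi; rewrite -fk; apply/eqP; rewrite -addr_eq0 addrC.
rewrite -kappa_comp //; last by case: hf.
by rewrite /kappa (hautK' hf) mulVg e2_1.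
Qed.

Lemma realizableZ (n : int) tau : realizable tau ->
  realizable (fun chi phi psi => n * tau chi phi psi).
Proof.
have nat_case (m : nat) : realizable tau ->
    realizable (fun chi phi psi => m%:Z * tau chi phi psi).
  move=> h; elim: m => [|m IH].
    by apply: realizable_ext realizable0 => *; rewrite mul0r.
  by apply: realizable_ext (realizableD h IH) => *; rewrite -addn1 PoszD; ring.
move=> h; case: n => m; first exact: nat_case.
apply: realizable_ext (realizableN (nat_case m.+1 h)) => *.
by rewrite NegzE mulNr.
Qed.
End Surface.

(** * Automorphisms supported on two handles *)
Section TwoHandles.
Variable g : nat.
Local Notation I := ('I_g + 'I_g)%type.
Local Notation F := (Fsurf g).
Local Notation x := (@xgen g).
Local Notation y := (@ygen g).
Implicit Types (phi psi chi : I -> int) (z u w p q : F) (i j k : 'I_g) (s : seq 'I_g) (f : F -> F).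

Lemma homology_id_gen (f : F -> F) : {morph f : u w / u * w} ->
  (forall phi j, e1 phi (f (x j)) = e1 phi (x j)) ->
  (forall phi j, e1 phi (f (y j)) = e1 phi (y j)) -> homology_id f.
Proof.
move=> fM hx hy phi z; rewrite (e1_comp _ _ fM); congr (e1 _ z).
by apply: funext => -[] j; rewrite ?hx ?hy e1_gen.
Qed.

Lemma fsurf_id (f : F -> F) : {morph f : u w / u * w} ->
  (forall j, f (x j) = x j) -> (forall j, f (y j) = y j) -> f =1 id.
Proof. by move=> fM hx hy; apply: eq_mult => // -[] j; rewrite ?hx ?hy. Qed.

(** ** Reordering the handles *)

Definition conj_handles (s : seq 'I_g) (c : F) : F -> F :=
  flift (fun t => fgen t ^ (if match t with inl k => k | inr k => k end \in s then c else 1)).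

Lemma conj_handlesM s c : {morph conj_handles s c : u w / u * w}.
Proof. exact: flift_morph. Qed.
Lemma conj_handles_x s c k : conj_handles s c (x k) = x k ^ (if k \in s then c else 1).
Proof. exact: flift_gen. Qed.
Lemma conj_handles_y s c k : conj_handles s c (y k) = y k ^ (if k \in s then c else 1).
Proof. exact: flift_gen. Qed.
Lemma conj_handles_handle s c k :
  conj_handles s c (handle k) = handle k ^ (if k \in s then c else 1).
Proof.
rewrite /handle (multR (@conj_handlesM s c)) conj_handles_x conj_handles_y.
by rewrite conjRg.
Qed.

Lemma conj_handles_cancel s c c' : conj_handles s c' c = c -> c' * c = 1 ->
  cancel (conj_handles s c) (conj_handles s c').
Proof.
move=> fc c'c; have M := @conj_handlesM s c'.
apply: fsurf_id => [u w|j|j]; first by rewrite conj_handlesM M.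
  rewrite conj_handles_x (multJ M) conj_handles_x.
  by case: ifP => _; rewrite ?(mult1 M) ?conjg1 // fc -conjgM c'c conjg1.
rewrite conj_handles_y (multJ M) conj_handles_y.
by case: ifP => _; rewrite ?(mult1 M) ?conjg1 // fc -conjgM c'c conjg1.
Qed.

Lemma i_star_x k : i_star (x k) = 1. Proof. exact: flift_gen. Qed.

Lemma i_star_xJ k w : i_star (x k ^ w) = 1.
Proof. by rewrite (multJ (@i_starM g)) i_star_x conj1g. Qed.

Lemma conj_handles_haut s i : i \notin s ->
  haut (conj_handles s (handle i)) (conj_handles s (handle i)^-1).
Proof.
move=> /negPf nis.
have fix_i c : conj_handles s c (handle i) = handle i.
  by rewrite conj_handles_handle nis conjg1.
split; try exact: conj_handlesM.
- by apply: conj_handles_cancel; rewrite ?fix_i ?mulVg.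
- apply: conj_handles_cancel; last exact: mulgV.
  by rewrite (multV (@conj_handlesM s _)) fix_i.
- by move=> j; rewrite conj_handles_x i_star_xJ.
- by move=> j; rewrite conj_handles_x i_star_xJ.
Qed.

Lemma conj_handles_homology s c : homology_id (conj_handles s c).
Proof.
apply: homology_id_gen; first exact: conj_handlesM.
  by move=> phi j; rewrite conj_handles_x e1J.
by move=> phi j; rewrite conj_handles_y e1J.
Qed.

Lemma bdry_seq_fix (f : F -> F) s : {morph f : u w / u * w} ->
  {in s, forall k, f (handle k) = handle k} -> f (bdry_seq s) = bdry_seq s.
Proof.
by move=> fM h; rewrite /bdry_seq (mult_prod fM) !big_seq; apply: eq_bigr.
Qed.

(** From [U * a = a * U ^ a]: conjugating the handles before [i] by the boundary curve
    of the handle [i] moves that handle to the front. *)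
Lemma bring_front s i : uniq s -> i \in s -> exists Q Q',
  [/\ haut Q Q', homology_id Q & Q (bdry_seq (i :: rem i s)) = bdry_seq s].
Proof.
move=> us /splitPr si; case: si us => u v us.
have niu : i \notin u by move: us; rewrite cat_uniq /= => /and3P[_ /norP[]].
exists (conj_handles u (handle i)), (conj_handles u (handle i)^-1).
split; [exact: conj_handles_haut|exact: conj_handles_homology|].
have -> : rem i (u ++ i :: v) = u ++ v.
  elim: (u) niu => [|a u' IH] /=; first by rewrite eqxx.
  by rewrite inE negb_or eq_sym => /andP[/negPf -> /IH ->].
have M := @conj_handlesM u (handle i).
rewrite /bdry_seq big_cons !big_cat big_cons /= (M (handle i)) conj_handles_handle M.
rewrite (negPf niu) conjg1 -/(bdry_seq u) -/(bdry_seq v).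
have -> : conj_handles u (handle i) (bdry_seq v) = bdry_seq v.
  apply: bdry_seq_fix => // k kv; rewrite conj_handles_handle.
  suff /negPf -> : k \notin u by rewrite conjg1.
  move: us; rewrite cat_uniq => /and3P[_ /hasPn h _].
  by apply: h; rewrite inE kv orbT.
have -> : conj_handles u (handle i) (bdry_seq u) = bdry_seq u ^ handle i.
  rewrite /bdry_seq (mult_prod M) conjg_prod !big_seq; apply: eq_bigr => k ku.
  by rewrite conj_handles_handle ku.
by rewrite conjgE !mulgA mulgV mul1g.
Qed.

Lemma bring_front2 i j : i != j -> exists s Q Q',
  [/\ haut Q Q', homology_id Q, uniq (i :: j :: s) &
      Q (bdry_seq (i :: j :: s)) = bdry g].
Proof.
rewrite bdryE => ij.
have := @mem_index_enum 'I_g; have := index_enum_uniq 'I_g.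
move: (index_enum _) => s1 u1 m1.
have [Q1 [Q1' [h1 k1 e1]]] := bring_front u1 (m1 j).
have u2 : uniq (j :: rem j s1).
  by rewrite cons_uniq rem_uniq // mem_rem_uniq // inE eqxx.
have i2 : i \in j :: rem j s1 by rewrite inE mem_rem_uniq // inE ij m1 orbT.
have [Q2 [Q2' [h2 k2 e2]]] := bring_front u2 i2.
exists (rem i (rem j s1)), (fun w => Q1 (Q2 w)), (fun w => Q2' (Q1' w)).
have es : rem i (j :: rem j s1) = j :: rem i (rem j s1).
  by rewrite [LHS]/= eq_sym (negPf ij).
rewrite -es; split.
- exact: haut_comp.
- exact: homology_id_comp.
- by rewrite cons_uniq rem_uniq // mem_rem_uniq // inE eqxx.
- by rewrite e2 e1.
Qed.

(** ** Changing the generators of two handles *)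
Section Update.
Variables i j : 'I_g.

Definition upd2 (p1 p2 p3 p4 : F) : F -> F := flift (fun t =>
  match t with
  | inl k => if k == i then p1 else if k == j then p3 else x k
  | inr k => if k == i then p2 else if k == j then p4 else y k
  end).

Variables p1 p2 p3 p4 : F.
Local Notation f := (upd2 p1 p2 p3 p4).

Lemma upd2M : {morph f : u w / u * w}. Proof. exact: flift_morph. Qed.
Lemma upd2_x k : f (x k) = if k == i then p1 else if k == j then p3 else x k.
Proof. exact: flift_gen. Qed.
Lemma upd2_y k : f (y k) = if k == i then p2 else if k == j then p4 else y k.
Proof. exact: flift_gen. Qed.
Lemma upd2_1x : f (x i) = p1. Proof. by rewrite upd2_x eqxx. Qed.
Lemma upd2_1y : f (y i) = p2. Proof. by rewrite upd2_y eqxx. Qed.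
Lemma upd2_2x : i != j -> f (x j) = p3.
Proof. by rewrite upd2_x eqxx eq_sym => /negPf ->. Qed.
Lemma upd2_2y : i != j -> f (y j) = p4.
Proof. by rewrite upd2_y eqxx eq_sym => /negPf ->. Qed.
Lemma upd2_x0 k : k != i -> k != j -> f (x k) = x k.
Proof. by rewrite upd2_x => /negPf -> /negPf ->. Qed.
Lemma upd2_y0 k : k != i -> k != j -> f (y k) = y k.
Proof. by rewrite upd2_y => /negPf -> /negPf ->. Qed.
End Update.

Lemma upd2_cancel i j p1 p2 p3 p4 (f' : F -> F) : {morph f' : u w / u * w} ->
  f' p1 = x i -> f' p2 = y i -> f' p3 = x j -> f' p4 = y j ->
  (forall k, k != i -> k != j -> f' (x k) = x k) ->
  (forall k, k != i -> k != j -> f' (y k) = y k) ->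
  cancel (upd2 i j p1 p2 p3 p4) f'.
Proof.
move=> f'M h1 h2 h3 h4 hx hy; apply: fsurf_id => [u w|k|k].
- by rewrite upd2M f'M.
- by rewrite upd2_x; case: eqVneq => [->|ki] //; case: eqVneq => [->|kj] //; apply: hx.
- by rewrite upd2_y; case: eqVneq => [->|ki] //; case: eqVneq => [->|kj] //; apply: hy.
Qed.

Lemma upd2_i_star i j p1 p2 p3 p4 : i_star p1 = 1 -> i_star p3 = 1 ->
  forall k, i_star (upd2 i j p1 p2 p3 p4 (x k)) = 1.
Proof.
by move=> h1 h3 k; rewrite upd2_x; case: ifP => // _; case: ifP => // _; apply: i_star_x.
Qed.

(** An automorphism that preserves the product of two handles preserves every boundary
    word in which they come first; conjugation by a reordering, which is
    trivial on [H], turns it into a mapping class with the same action on [H]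
    and the same tensor. *)
Lemma two_handle_mcg i j f f' : i != j -> haut f f' ->
  (forall k, k != i -> k != j -> f (handle k) = handle k) ->
  f (handle i * handle j) = handle i * handle j ->
  exists b b', [/\ haut b b', b (bdry g) = bdry g,
    (forall phi z, e1 phi (b z) = e1 phi (f z)) &
    forall U V W, realizes f (hdet U V W) -> realizes b (hdet U V W)].
Proof.
move=> ij hf f0 f2; have [s [Q [Q' [hQ Qh us Qs]]]] := bring_front2 ij.
have fM := hautM hf.
have Qh' : homology_id Q' := homology_id_inv (hautK' hQ) Qh.
exists (fun w => Q (f (Q' w))), (fun w => Q (f' (Q' w))); split.
- by have := haut_comp hQ (haut_comp hf (haut_sym hQ)).
- rewrite -Qs (hautK hQ); congr (Q _); rewrite /bdry_seq !big_cons (mulgA (handle i)) fM f2.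
  congr (_ * _); apply: bdry_seq_fix => // k ks; apply: f0.
    by apply: contraTneq us => <-; rewrite /= inE ks orbT.
  by apply: contraTneq us => <-; rewrite /= ks andbF.
- by move=> phi z; rewrite Qh !(e1_comp _ _ fM) Qh'.
move=> U V W rf; have := realizes_conj hQ hf (homology_id_sympl Qh) rf.
by move=> [h k]; split=> // z phi psi; rewrite k /hdet !Qh.
Qed.
End TwoHandles.

(** ** Shears, clasps, slides and pushes *)

Section Words.
Variable G : groupType.
Implicit Types a b c d p q w z : G.

(** Write [[p, q] = (q^-1) ^ p * q]. An element [a] standing before it is carried past
    the factor [z = (q^-1) ^ p] as [a ^ z], at the price of conjugating that factor by
    [a ^ z], that is, of replacing [p] by [p * a ^ z]. With [a] the foot
    [x_i ^ y_i] of a handle this is the slide, with [a] a whole handle it is the push. *)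
Lemma push_word a p q :
  a ^ (q^-1 ^ p) * [~ p * a ^ (q^-1 ^ p), q] = a * [~ p, q].
Proof.
set z := q^-1 ^ p; rewrite !commgEr (conjgM _ p) -/z [z ^ (a ^ z)]conjgE.
by rewrite (mulgA (a ^ z)) mulVKg -conjgC -mulgA.
Qed.

(** Write [[a, b] * [c, d] = a^-1 * (a ^ b) * (c^-1) * (c ^ d)]. The full twist of the
    two middle factors conjugates both by their product [w]. *)
Lemma clasp_word a b c d : let w := a ^ b * c^-1 in
  [~ a, b * w] * [~ c ^ w, w^-1 * d] = [~ a, b] * [~ c, d].
Proof.
move=> w.
have -> : [~ a, b * w] = a^-1 * (a ^ b) ^ w by rewrite commgEl (conjgM _ b).
have -> : [~ c ^ w, w^-1 * d] = c^-1 ^ w * c ^ d.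
  by rewrite commgEl (conjgM _ w^-1) conjgK conjVg.
rewrite -mulgA (mulgA (_ ^ w)) -conjMg -/w [w ^ w]conjgE mulKg /w !commgEl.
by move: (a ^ b) (c ^ d) => A D; rewrite !mulgA.
Qed.

Lemma conj_cancel a p q : (a ^ (p^-1 ^ q)) ^ (p ^ q) = a.
Proof. by rewrite -conjgM -conjMg mulVg conj1g conjg1. Qed.

Lemma conj_cancelV p q : (p ^ q)^-1 ^ q^-1 = p^-1.
Proof. by rewrite -conjVg conjgK. Qed.
End Words.

Section Moves.
Variable g : nat.
Local Notation I := ('I_g + 'I_g)%type.
Local Notation F := (Fsurf g).
Local Notation x := (@xgen g).
Local Notation y := (@ygen g).
Implicit Types (phi psi chi : I -> int) (z u w p q : F) (i j k : 'I_g) (s : seq 'I_g).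

Definition clasp_loop i j : F := x i ^ y i * (x j)^-1.
Definition slide_loop j : F := (y j)^-1 ^ x j.

Definition clasp i j : F -> F := let w := clasp_loop i j in
  upd2 i j (x i) (y i * w) (x j ^ w) (w^-1 * y j).
Definition clasp_inv i j : F -> F := let w := clasp_loop i j in
  upd2 i j (x i) (y i * w^-1) (x j ^ w^-1) (w * y j).

Lemma clasp_fix i j : i != j -> clasp i j (clasp_loop i j) = clasp_loop i j.
Proof.
move=> ij; rewrite {2}/clasp_loop.
have M : {morph clasp i j : u w / u * w} by exact: upd2M.
rewrite M (multJ M) (multV M) /clasp upd2_1x upd2_1y (upd2_2x _ _ _ _ ij).
by rewrite conjgM -conjVg -conjMg -/(clasp_loop i j) conjgE mulKg.
Qed.

Lemma clasp_inv_fix i j : i != j -> clasp_inv i j (clasp_loop i j) = clasp_loop i j.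
Proof.
move=> ij; rewrite {2}/clasp_loop.
have M : {morph clasp_inv i j : u w / u * w} by exact: upd2M.
rewrite M (multJ M) (multV M) /clasp_inv upd2_1x upd2_1y (upd2_2x _ _ _ _ ij).
by rewrite conjgM -conjVg -conjMg -/(clasp_loop i j) conjgE invgK mulgV mulg1.
Qed.

Lemma clasp_haut i j : i != j -> haut (clasp i j) (clasp_inv i j).
Proof.
move=> ij.
have M : {morph clasp i j : u w / u * w} by exact: upd2M.
have M' : {morph clasp_inv i j : u w / u * w} by exact: upd2M.
have e := clasp_fix ij; have e' := clasp_inv_fix ij.
split=> //.
- apply: upd2_cancel => //; try exact: upd2_x0; try exact: upd2_y0.
  + exact: upd2_1x.
  + by rewrite M' e' /clasp_inv upd2_1y ?mulgVK ?mulgK.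
  + by rewrite (multJ M') e' /clasp_inv (upd2_2x _ _ _ _ ij) conjgKV.
  + by rewrite M' (multV M') e' /clasp_inv (upd2_2y _ _ _ _ ij) mulKg.
- apply: upd2_cancel => //; try exact: upd2_x0; try exact: upd2_y0.
  + exact: upd2_1x.
  + by rewrite M (multV M) e /clasp upd2_1y ?mulgVK ?mulgK.
  + by rewrite (multJ M) (multV M) e /clasp (upd2_2x _ _ _ _ ij) conjgK.
  + by rewrite M e /clasp (upd2_2y _ _ _ _ ij) mulVKg.
- by apply: upd2_i_star; rewrite ?i_star_xJ ?i_star_x.
- by apply: upd2_i_star; rewrite ?i_star_xJ ?i_star_x.
Qed.

Lemma upd2_handle0 i j p1 p2 p3 p4 k : k != i -> k != j ->
  upd2 i j p1 p2 p3 p4 (handle k) = handle k.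
Proof.
move=> ki kj; rewrite (multR (@upd2M _ _ _ _ _ _ _)).
by rewrite upd2_x0 // upd2_y0.
Qed.

Lemma upd2_handles i j p1 p2 p3 p4 : i != j ->
  upd2 i j p1 p2 p3 p4 (handle i * handle j) = [~ p1, p2] * [~ p3, p4].
Proof.
move=> ij; rewrite upd2M !(multR (@upd2M _ _ _ _ _ _ _)).
by rewrite upd2_1x upd2_1y upd2_2x // upd2_2y.
Qed.

Local Open Scope ring_scope.

(** The clasp yields the symmetric matrix with diagonal entries [1] and off-diagonal
    entries [-1]; the shears correct the diagonal. *)
Lemma clasp_mcg i j : i != j -> exists b b', [/\ haut b b', b (bdry g) = bdry g,
  (forall phi k, e1 phi (b (x k)) = e1 phi (x k)) &
  (forall phi k, e1 phi (b (y k)) = e1 phi (y k) +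
    (if k == i then e1 phi (x i) - e1 phi (x j) else
     if k == j then e1 phi (x j) - e1 phi (x i) else 0))].
Proof.
move=> ij; have [|| b [b' [hb bd bh _]]] := two_handle_mcg ij (clasp_haut ij).
- by move=> k; apply: upd2_handle0.
- by rewrite [LHS](upd2_handles _ _ _ _ ij); apply: clasp_word.
have eloop phi : e1 phi (clasp_loop i j) = e1 phi (x i) - e1 phi (x j).
  by rewrite e1M e1J e1V.
exists b, b'; split=> // phi k; rewrite bh.
  rewrite /clasp upd2_x; case: eqVneq => [->|_] //; case: eqVneq => [->|_] //.
  by rewrite e1J.
rewrite /clasp upd2_y; case: eqVneq => [->|_]; first by rewrite e1M eloop.
case: eqVneq => [->|_]; last by rewrite addr0.
by rewrite e1M e1V eloop; ring.
Qed.

Lemma shear_mcg i : exists b b', [/\ haut b b', b (bdry g) = bdry g,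
  (forall phi k, e1 phi (b (x k)) = e1 phi (x k)) &
  (forall phi k, e1 phi (b (y k)) = e1 phi (y k) +
    (if k == i then e1 phi (x i) else 0))].
Proof.
pose b := upd2 i i (x i) (x i * y i)%g (x i) (x i * y i)%g.
pose b' := upd2 i i (x i) ((x i)^-1 * y i)%g (x i) ((x i)^-1 * y i)%g.
have M : {morph b : u w / (u * w)%g} by exact: upd2M.
have M' : {morph b' : u w / (u * w)%g} by exact: upd2M.
exists b, b'; split.
- split=> //.
  + apply: upd2_cancel => //; try exact: upd2_x0; try exact: upd2_y0;
      rewrite ?M' ?(multV M') /b' ?upd2_1x ?upd2_1y //; by rewrite mulVKg.
  + apply: upd2_cancel => //; try exact: upd2_x0; try exact: upd2_y0;
      rewrite ?M ?(multV M) /b ?upd2_1x ?upd2_1y //; by rewrite mulKg.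
  + by apply: upd2_i_star; rewrite i_star_x.
  + by apply: upd2_i_star; rewrite i_star_x.
- rewrite bdryE; apply: bdry_seq_fix => // k _; have [->|ki] := eqVneq k i.
    by rewrite (multR M) /b upd2_1x upd2_1y /handle !commgEl conjgM [(x i ^ x i)%g]conjgE mulKg.
  exact: upd2_handle0.
- by move=> phi k; rewrite /b upd2_x; case: eqVneq => [->|].
move=> phi k; rewrite /b upd2_y; case: eqVneq => [->|_]; last by rewrite addr0.
by rewrite e1M addrC.
Qed.


(** Dragging the foot [x_i ^ y_i] once along [y_j]. *)
Lemma slide_mcg i j : i != j -> exists b b', [/\ haut b b', b (bdry g) = bdry g,
  (forall phi k, e1 phi (b (x k)) = e1 phi (x k) +
    (if k == j then e1 phi (x i) else 0)) &
  (forall phi k, e1 phi (b (y k)) = e1 phi (y k) -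
    (if k == i then e1 phi (y j) else 0))].
Proof.
move=> ij; pose v := (x i ^ y i)%g; pose z := slide_loop j.
pose f := upd2 i j (x i) (y i * z)%g (x j * v ^ z)%g (y j).
pose f' := upd2 i j (x i) (y i * z^-1 ^ v^-1)%g (x j * v^-1)%g (y j).
have M : {morph f : u w / (u * w)%g} by exact: upd2M.
have M' : {morph f' : u w / (u * w)%g} by exact: upd2M.
have fv : f v = (v ^ z)%g.
  by rewrite (multJ M) /f upd2_1x upd2_1y conjgM.
have fz : f z = (z ^ (v ^ z))%g.
  by rewrite (multJ M) (multV M) /f (upd2_2x _ _ _ _ ij) (upd2_2y _ _ _ _ ij) conjgM.
have f'v : f' v = (v ^ (z^-1 ^ v^-1))%g.
  by rewrite (multJ M') /f' upd2_1x upd2_1y conjgM.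
have f'z : f' z = (z ^ v^-1)%g.
  by rewrite (multJ M') (multV M') /f' (upd2_2x _ _ _ _ ij) (upd2_2y _ _ _ _ ij) conjgM.
have hf : haut f f'.
  split=> //.
  - apply: upd2_cancel => //; try exact: upd2_x0; try exact: upd2_y0.
    + exact: upd2_1x.
    + by rewrite M' f'z /f' upd2_1y -mulgA -conjMg mulVg conj1g mulg1.
    + by rewrite M' (multJ M') f'v f'z /f' (upd2_2x _ _ _ _ ij) conj_cancel mulgVK.
    + exact: upd2_2y.
  - apply: upd2_cancel => //; try exact: upd2_x0; try exact: upd2_y0.
    + exact: upd2_1x.
    + by rewrite M (multJ M) (multV M z) (multV M v) fv fz /f upd2_1y conj_cancelV mulgK.
    + by rewrite M (multV M) fv /f (upd2_2x _ _ _ _ ij) mulgK.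
    + exact: upd2_2y.
  - apply: upd2_i_star; rewrite ?i_star_x //.
    by rewrite i_starM (multJ (@i_starM g)) i_star_xJ conj1g i_star_x mulg1.
  - apply: upd2_i_star; rewrite ?i_star_x //.
    by rewrite i_starM (multV (@i_starM g)) i_star_xJ i_star_x invg1 mulg1.
have [|| b [b' [hb bd bh _]]] := two_handle_mcg ij hf.
- by move=> k; apply: upd2_handle0.
- rewrite [LHS](upd2_handles _ _ _ _ ij) commgEl (conjgM _ (y i)) -mulgA (push_word v).
  by rewrite mulgA -commgEl.
exists b, b'; split=> // phi k; rewrite bh.
  rewrite /f upd2_x; case: eqVneq => [->|_]; first by rewrite (negPf ij) addr0.
  by case: eqVneq => [->|_]; rewrite ?addr0 // e1M !e1J.
rewrite /f upd2_y; case: eqVneq => [->|_]; first by rewrite e1M e1J e1V.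
by case: eqVneq => [->|_]; rewrite subr0.
Qed.

Lemma om_xx k l : e1 (om (x k)) (x l) = 0.
Proof. by rewrite e1_gen /= e1_gen /dual oppr0. Qed.
Lemma om_xy k l : e1 (om (x k)) (y l) = (k == l)%:R.
Proof. by rewrite e1_gen /= e1_gen /dual (inj_eq (@inl_inj _ _)). Qed.
Lemma om_yx k l : e1 (om (y k)) (x l) = - (k == l)%:R.
Proof. by rewrite e1_gen /= e1_gen /dual (inj_eq (@inr_inj _ _)). Qed.
Lemma om_yy k l : e1 (om (y k)) (y l) = 0.
Proof. by rewrite e1_gen /= e1_gen /dual. Qed.

(** Dragging the handle [i] once along [y_j]. *)
Lemma push_realizable i j : i != j -> realizable (hdet (x i) (y i) (y j)).
Proof.
move=> ij; pose a := handle i; pose z := slide_loop j.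
pose f := upd2 i j (x i ^ z)%g (y i ^ z)%g (x j * a ^ z)%g (y j).
pose f' := upd2 i j (x i ^ (z^-1 ^ a^-1))%g (y i ^ (z^-1 ^ a^-1))%g (x j * a^-1)%g (y j).
have M : {morph f : u w / (u * w)%g} by exact: upd2M.
have M' : {morph f' : u w / (u * w)%g} by exact: upd2M.
have fa : f a = (a ^ z)%g.
  by rewrite (multR M) /f upd2_1x upd2_1y -conjRg.
have fz : f z = (z ^ (a ^ z))%g.
  by rewrite (multJ M) (multV M) /f (upd2_2x _ _ _ _ ij) (upd2_2y _ _ _ _ ij) conjgM.
have f'a : f' a = (a ^ (z^-1 ^ a^-1))%g.
  by rewrite (multR M') /f' upd2_1x upd2_1y -conjRg.
have f'z : f' z = (z ^ a^-1)%g.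
  by rewrite (multJ M') (multV M') /f' (upd2_2x _ _ _ _ ij) (upd2_2y _ _ _ _ ij) conjgM.
have ia : i_star a = 1%g.
  by rewrite (multR (@i_starM g)) i_star_x comm1g.
have hf : haut f f'.
  split=> //.
  - apply: upd2_cancel => //; try exact: upd2_x0; try exact: upd2_y0.
    + by rewrite (multJ M') f'z /f' upd2_1x conj_cancel.
    + by rewrite (multJ M') f'z /f' upd2_1y conj_cancel.
    + by rewrite M' (multJ M') f'a f'z /f' (upd2_2x _ _ _ _ ij) conj_cancel mulgVK.
    + exact: upd2_2y.
  - apply: upd2_cancel => //; try exact: upd2_x0; try exact: upd2_y0.
    + by rewrite (multJ M) (multJ M z^-1) (multV M z) (multV M a)
        fa fz /f upd2_1x conj_cancelV conjgK.
    + by rewrite (multJ M) (multJ M z^-1) (multV M z) (multV M a)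
        fa fz /f upd2_1y conj_cancelV conjgK.
    + by rewrite M (multV M) fa /f (upd2_2x _ _ _ _ ij) mulgK.
    + exact: upd2_2y.
  - apply: upd2_i_star; rewrite ?i_star_xJ //.
    by rewrite i_starM (multJ (@i_starM g)) ia conj1g i_star_x mulg1.
  - apply: upd2_i_star; rewrite ?i_star_xJ //.
    by rewrite i_starM (multV (@i_starM g)) ia i_star_x invg1 mulg1.
have [|| b [b' [hb bd bh br]]] := two_handle_mcg ij hf.
- by move=> k; apply: upd2_handle0.
- rewrite [LHS](upd2_handles _ _ _ _ ij) -conjRg; exact: push_word.
exists b, b'; split=> //; apply: br.
have fh : homology_id f.
  apply: homology_id_gen => // phi k; rewrite /f.
    rewrite upd2_x; case: eqVneq => [->|_]; first by rewrite e1J.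
    by case: eqVneq => [->|_] //; rewrite e1M e1J e1R addr0.
  rewrite upd2_y; case: eqVneq => [->|_]; first by rewrite e1J.
  by case: eqVneq => [->|_].
split=> // w phi psi.
have ez : forall phi, e1 phi z = - e1 phi (y j) by move=> ph; rewrite e1J e1V.
have hk := kappaM (f := f) phi psi _ _ M fh.
rewrite (e1_uniq hk) (_ : hdet _ _ _ _ _ _ =
  e1 (fun t => hdet (x i) (y i) (y j) (om (fgen t)) phi psi) w); last first.
  rewrite -(e1_uniq (f := fun w => hdet (x i) (y i) (y j) (om w) phi psi)) // => u1 u2.
  by rewrite /hdet !e1_gen /om !e1M; ring.
congr (e1 _ w); apply: funext => -[] k; rewrite /kappa /f -/(x k) -/(y k) /hdet.
  rewrite om_xx !om_xy upd2_x; case: eqVneq => [->|ki].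
    by rewrite -commgEl e2R !ez (negPf ij) mulr1n mulr0n; ring.
  case: eqVneq => [->|kj]; last by rewrite mulVg e2_1 mulr0n; ring.
  by rewrite mulKg e2J_lcs2 ?e2R ?mulr1n ?mulr0n; [ring|apply: lcs_comm].
rewrite om_yx !om_yy upd2_y; case: eqVneq => [->|ki].
  by rewrite -commgEl e2R !ez mulr1n; ring.
by case: eqVneq => [->|kj]; rewrite mulVg e2_1 mulr0n; ring.
Qed.
End Moves.

(** * Realizing symmetric matrices and elementary tensors *)

Section Generation.
Variable g : nat.
Local Notation I := ('I_g + 'I_g)%type.
Local Notation F := (Fsurf g).
Local Notation x := (@xgen g).
Local Notation y := (@ygen g).
Implicit Types (phi psi chi : I -> int) (z u w U V W : F) (i j k l : 'I_g) (s : seq 'I_g).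
Local Open Scope ring_scope.

(** Removing from [f] a multiple of an elementary solution [e] that agrees with [f] at a
    point and lives on the support of [f] shrinks the support. *)
Lemma support_ind (A : finType) (C R : (A -> int) -> Prop) :
  (forall f, (forall a, f a = 0) -> R f) ->
  (forall f a, C f -> f a != 0 -> exists2 e : A -> int,
     [/\ C (fun b => f b - e b), e a = f a & forall b, f b = 0 -> e b = 0] &
     R (fun b => f b - e b) -> R f) ->
  forall f, C f -> R f.
Proof.
move=> R0 step f; have [n] := ubnP #|[pred a | f a != 0]|.
elim: n f => // n IH f sz Cf.
case: (pickP [pred a | f a != 0]) => [a /= fa|f0]; last first.
  by apply: R0 => a; have /negbFE/eqP := f0 a.
have [e [Ce ea e0] Re] := step f a Cf fa.
apply: Re; apply: IH => //; rewrite ltnS in sz; apply: leq_trans sz.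
apply: proper_card; apply/properP; split.
  by apply/fintype.subsetP => b; rewrite !inE; apply: contraNneq => fb; rewrite fb e0 // subr0.
by exists a; rewrite !inE // ea subrr eqxx.
Qed.

(** ** Handlebody classes acting unipotently on homology *)

Definition twist (m : 'I_g -> 'I_g -> int) := exists b b' : F -> F,
  [/\ haut b b', b (bdry g) = bdry g,
    (forall phi k, e1 phi (b (x k)) = e1 phi (x k)) &
    (forall phi k, e1 phi (b (y k)) = e1 phi (y k) + \sum_l m l k * e1 phi (x l))].

Lemma twist_ext m m' : (forall i j, m i j = m' i j) -> twist m -> twist m'.
Proof.
move=> e [b [b' [hb bd bx by_]]]; exists b, b'; split=> // phi k.
by rewrite by_; congr (_ + _); apply: eq_bigr => l _; rewrite e.
Qed.

Lemma twist0 : twist (fun _ _ => 0).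
Proof.
exists id, id; split=> //; first exact: haut_id.
by move=> phi k; rewrite big1 ?addr0 // => l _; rewrite mul0r.
Qed.

Lemma twistD m m' : twist m -> twist m' -> twist (fun i j => m i j + m' i j).
Proof.
move=> [b [b' [hb bd bx by_]]] [c [c' [hc cd cx cy]]].
exists (fun w => b (c w)), (fun w => c' (b' w)); split.
- exact: haut_comp.
- by rewrite cd bd.
- by move=> phi k; rewrite (e1_comp _ _ (hautM hb)) cx -(e1_comp _ _ (hautM hb)) bx.
move=> phi k; rewrite (e1_comp _ _ (hautM hb)) cy -(e1_comp _ _ (hautM hb)) by_.
rewrite -addrA -big_split; congr (_ + _); apply: eq_bigr => l _.
by rewrite -(e1_comp _ _ (hautM hb)) bx mulrDl.
Qed.

Lemma twistN m : twist m -> twist (fun i j => - m i j).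
Proof.
move=> [b [b' [hb bd bx by_]]].
have b'x phi k : e1 phi (b' (x k)) = e1 phi (x k).
  by rewrite (e1_comp _ _ (hautM' hb)) -[LHS]bx -(e1_comp _ _ (hautM' hb)) (hautK hb).
exists b', b; split=> //; first exact: haut_sym.
  by rewrite -[in LHS]bd (hautK hb).
move=> phi k; have := by_ (fun t : I => e1 phi (b' (fgen t))) k.
rewrite -!(e1_comp _ _ (hautM' hb)) (hautK hb) => ->.
rewrite -addrA -big_split big1 /= ?addr0 // => l _.
by rewrite -(e1_comp _ _ (hautM' hb)) b'x mulNr subrr.
Qed.

Lemma twistZ (n : int) m : twist m -> twist (fun i j => n * m i j).
Proof.
have nat_case (a : nat) : twist m -> twist (fun i j => a%:Z * m i j).
  move=> h; elim: a => [|a IH].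
    by apply: twist_ext twist0 => *; rewrite mul0r.
  by apply: twist_ext (twistD h IH) => *; rewrite -addn1 PoszD; ring.
move=> h; case: n => a; first exact: nat_case.
apply: twist_ext (twistN (nat_case a.+1 h)) => *.
by rewrite NegzE mulNr.
Qed.

Definition elem i j l k : int := ((l == i) && (k == j))%:R.

Lemma sum_elem i j k (G : 'I_g -> int) :
  \sum_l elem i j l k * G l = if k == j then G i else 0.
Proof.
rewrite (bigD1 i) //= big1 => [|l /negPf li]; last by rewrite /elem li mul0r.
by rewrite /elem eqxx addr0; case: (k == j); rewrite ?mul1r ?mul0r.
Qed.

Lemma sum_cross i j k (G : 'I_g -> int) :
  \sum_l (elem i j l k + elem j i l k) * G l =
  (if k == j then G i else 0) + (if k == i then G j else 0).
Proof.
by rewrite -!(sum_elem _ _ k G) -big_split; apply: eq_bigr => l _; rewrite mulrDl.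
Qed.

Lemma twist_diag i : twist (elem i i).
Proof.
have [b [b' [hb bd bx by_]]] := shear_mcg i; exists b, b'; split=> // phi k.
by rewrite by_ sum_elem.
Qed.

Lemma twist_cross i j : i != j -> twist (fun l k => elem i j l k + elem j i l k).
Proof.
move=> ij; have [b [b' [hb bd bx by_]]] := clasp_mcg ij.
have tb : twist (fun l k => elem i i l k + elem j j l k - elem i j l k - elem j i l k).
  exists b, b'; split=> // phi k; rewrite by_; congr (_ + _).
  rewrite (eq_bigr (fun l => elem i i l k * e1 phi (x l) + elem j j l k * e1 phi (x l)
     - elem i j l k * e1 phi (x l) - elem j i l k * e1 phi (x l))); last first.
    by move=> l _; rewrite !mulrBl mulrDl.
  rewrite !sumrB big_split /= !sum_elem.
  case: (eqVneq k i) => [->|ki]; first by rewrite (negPf ij); ring.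
  by case: eqVneq => _; ring.
apply: twist_ext (twistD (twistD (twist_diag i) (twist_diag j)) (twistN tb)) => l k.
by ring.
Qed.

Lemma twist_sym m : (forall i j, m i j = m j i) -> twist m.
Proof.
pose C (f : 'I_g * 'I_g -> int) := forall i j, f (i, j) = f (j, i).
pose R (f : 'I_g * 'I_g -> int) := twist (fun i j => f (i, j)).
move=> ms; suff : forall f, C f -> R f by move=> /(_ (fun p => m p.1 p.2)); apply.
apply: support_ind => {m ms}.
  by move=> f f0; apply: twist_ext twist0 => i j; rewrite f0.
move=> f [i j] Cf fij.
have elemC a b c d : elem a b c d = elem b a d c by rewrite /elem andbC.
have vanish a b : f (a, b) = f (i, j) -> forall p, f p = 0 -> f (i, j) * elem a b p.1 p.2 = 0.
  move=> e [c d]; rewrite /elem /=; case: eqVneq => [->|]; last by rewrite mulr0.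
  case: eqVneq => [->|]; last by rewrite mulr0.
  by rewrite e => ->; rewrite mul0r.
have [eij|ij] := eqVneq i j.
  rewrite -{j}eij in fij vanish *.
  exists (fun p => f (i, i) * elem i i p.1 p.2).
    split; last exact: vanish.
    - by move=> a b /=; rewrite Cf elemC.
    - by rewrite /elem /= eqxx mulr1.
  move=> h; apply: twist_ext (twistD h (twistZ (f (i, i)) (twist_diag i))) => a b /=.
  by rewrite subrK.
exists (fun p => f (i, j) * (elem i j p.1 p.2 + elem j i p.1 p.2)).
  split.
  - by move=> a b /=; rewrite Cf [elem i j b a]elemC [elem j i b a]elemC [elem j i _ _ + _]addrC.
  - by rewrite /elem /= !eqxx (negPf ij) addr0 mulr1.
  - by move=> p fp; rewrite mulrDr !vanish // ?addr0 // Cf.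
move=> h; apply: twist_ext (twistD h (twistZ (f (i, j)) (twist_cross ij))) => a b /=.
by rewrite subrK.
Qed.

(** ** Realizing decomposable tensors *)

Lemma realizable_act b b' U V W : haut b b' -> b (bdry g) = bdry g ->
  realizable (hdet U V W) -> realizable (hdet (b U) (b V) (b W)).
Proof.
move=> hb bd [f [f' [hf fd rf]]].
exists (fun w => b (f (b' w))), (fun w => b (f' (b' w))); split.
- by have := haut_comp hb (haut_comp hf (haut_sym hb)).
- by rewrite -[in LHS]bd (hautK hb) fd bd.
apply: (realizes_conj hb hf) rf.
exact: (bdry_sympl (hautM hb) (hautM' hb) (hautK hb) (hautK' hb) bd).
Qed.

Lemma realizable_swap12 U V W : realizable (hdet U V W) -> realizable (hdet V U W).
Proof.
by move=> /realizableN; apply: realizable_ext => chi phi psi; rewrite /hdet; ring.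
Qed.

Lemma realizable_swap23 U V W : realizable (hdet U V W) -> realizable (hdet U W V).
Proof.
by move=> /realizableN; apply: realizable_ext => chi phi psi; rewrite /hdet; ring.
Qed.

Lemma realizable_rot U V W : realizable (hdet U V W) -> realizable (hdet V W U).
Proof. by move=> /realizable_swap12/realizable_swap23. Qed.

(** The slide of [i] over [j] sends [x_i /\ y_i /\ y_k] to
    [x_i /\ (y_i - y_j) /\ y_k]; the difference is the tensor sought. *)
Lemma realizable_xyy i j k : i != j -> j != k -> i != k ->
  realizable (hdet (x i) (y j) (y k)).
Proof.
move=> ij jk ik; have [b [b' [hb bd bx by_]]] := slide_mcg ij.
have h := push_realizable ik; have h' := realizable_act hb bd h.
apply: realizable_ext (realizableD h (realizableN h')) => chi phi psi.
rewrite /hdet !bx !by_ eqxx (negPf ij) [k == i]eq_sym (negPf ik); ring.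
Qed.

(** The transvection [y_i |-> y_i + x_j], [y_j |-> y_j + x_i] sends
    [x_i /\ y_i /\ y_j] to [x_i /\ (y_i + x_j) /\ y_j], as the terms containing
    [x_i] twice vanish. *)
Lemma realizable_xxy1 i j : i != j -> realizable (hdet (x i) (x j) (y j)).
Proof.
move=> ij; have [b [b' [hb bd bx by_]]] := twist_cross ij.
have h := push_realizable ij; have h' := realizable_act hb bd h.
apply: realizable_ext (realizableD h' (realizableN h)) => chi phi psi.
have by2 ph k : e1 ph (b (y k)) = e1 ph (y k) + ((if k == j then e1 ph (x i) else 0) +
   (if k == i then e1 ph (x j) else 0)).
  by rewrite by_ sum_cross.
rewrite /hdet !bx !by2 !eqxx (negPf ij) eq_sym (negPf ij); ring.
Qed.

(** Slide [j] over [k] in [x_i /\ x_j /\ y_j]. *)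
Lemma realizable_xxy i j k : i != j -> j != k -> i != k ->
  realizable (hdet (x i) (x j) (y k)).
Proof.
move=> ij jk ik; have [b [b' [hb bd bx by_]]] := slide_mcg jk.
have h := realizable_xxy1 ij; have h' := realizable_act hb bd h.
apply: realizable_ext (realizableD h (realizableN h')) => chi phi psi.
rewrite /hdet !bx !by_ !eqxx (negPf ik) (negPf jk); ring.
Qed.

(** Apply [y_j |-> y_j + x_k], [y_k |-> y_k + x_j] to [x_i /\ x_j /\ y_j]. *)
Lemma realizable_xxx i j k : i != j -> j != k -> i != k ->
  realizable (hdet (x i) (x j) (x k)).
Proof.
move=> ij jk ik; have [b [b' [hb bd bx by_]]] := twist_cross jk.
have h := realizable_xxy1 ij; have h' := realizable_act hb bd h.
apply: realizable_ext (realizableD h' (realizableN h)) => chi phi psi.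
have by2 ph n : e1 ph (b (y n)) = e1 ph (y n) + ((if n == k then e1 ph (x j) else 0) +
   (if n == j then e1 ph (x k) else 0)).
  by rewrite by_ sum_cross.
rewrite /hdet !bx !by2 !eqxx (negPf jk); ring.
Qed.

Definition is_x (a : I) := if a is inl _ then true else false.

Lemma realizable_x1 i (b c : I) : inl i != b -> b != c -> inl i != c ->
  realizable (hdet (x i) (fgen b) (fgen c)).
Proof.
case: b => j; case: c => k; rewrite ?(inj_eq (@inl_inj _ _)) ?(inj_eq (@inr_inj _ _)) => ij jk ik.
- exact: realizable_xxx.
- have [<-|ik'] := eqVneq i k.
    by apply: realizable_swap12; apply: realizable_xxy1; rewrite eq_sym.
  by have [<-|jk'] := eqVneq j k; [apply: realizable_xxy1|apply: realizable_xxy].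
- apply: realizable_swap23; have [<-|ij'] := eqVneq i j.
    by apply: realizable_swap12; apply: realizable_xxy1; rewrite eq_sym.
  have [<-|jk'] := eqVneq j k; first exact: realizable_xxy1.
  by apply: realizable_xxy; rewrite // eq_sym.
have [eij|ij'] := eqVneq i j; first by rewrite -eij in jk *; apply: push_realizable.
have [<-|ik'] := eqVneq i k; last exact: realizable_xyy.
by apply: realizable_swap23; apply: push_realizable.
Qed.
End Generation.

(** * The tensor of a Torelli class *)

Section Tensor.
Variable g : nat.
Local Notation I := ('I_g + 'I_g)%type.
Local Notation F := (Fsurf g).
Local Notation x := (@xgen g).
Local Notation y := (@ygen g).
Implicit Types (phi psi chi : I -> int) (z u w U V W : F) (i j k l : 'I_g) (s : seq 'I_g)
  (a b c : I).
Local Open Scope ring_scope.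

(** For a Torelli class [h] the matrices of [z] and of [h z] have the same
    superdiagonal, so only the terms linear in the second diagonal survive in the
    difference. *)
Lemma ut4_comm_diff (A A' B B' : ut4) :
  a12 A' = a12 A -> a23 A' = a23 A -> a34 A' = a34 A ->
  a12 B' = a12 B -> a23 B' = a23 B -> a34 B' = a34 B ->
  a14 [~ A', B']%g = a14 [~ A, B]%g +
    (a12 A * (a24 B' - a24 B) - (a13 B' - a13 B) * a34 A
     + ((a13 A' - a13 A) * a34 B - a12 B * (a24 A' - a24 A))).
Proof.
move=> e1 e2 e3 e4 e5 e6; rewrite !commgEl !conjgE !ut4_mulE /= e1 e2 e3 e4 e5 e6.
ring.
Qed.

Section Torelli.
Variable h : F -> F.
Hypothesis hM : {morph h : u w / (u * w)%g}.
Hypothesis hid : homology_id h.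
Hypothesis hbd : h (bdry g) = bdry g.

Lemma kappaE phi psi z : kappa h phi psi z = e2 phi psi (h z) - e2 phi psi z.
Proof. by rewrite /kappa e2M e2V e1V hid; ring. Qed.

(** The cubic part of [h (bdry g) = bdry g]: the image of the tensor of [h] under the
    bracket of [H (x) F_2/F_3] into [F_3/F_4] vanishes. *)
Lemma bdry_cubic phi psi chi :
  \sum_j (phi (inl j) * kappa h psi chi (y j) - kappa h phi psi (y j) * chi (inl j)
    + (kappa h phi psi (x j) * chi (inr j) - phi (inr j) * kappa h psi chi (x j))) = 0.
Proof.
pose r := rho phi psi chi; have rM : {morph r : u w / (u * w)%g} := rhoM _ _ _.
have key s : a14 (r (h (bdry_seq s))) = a14 (r (bdry_seq s)) +
  \sum_(j <- s) (phi (inl j) * kappa h psi chi (y j) - kappa h phi psi (y j) * chi (inl j)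
    + (kappa h phi psi (x j) * chi (inr j) - phi (inr j) * kappa h psi chi (x j))).
  elim: s => [|j s IH].
    by rewrite /bdry_seq !big_nil (mult1 hM) addr0.
  have e34 w : a34 (r w) = e1 chi w by case: (rho_diag phi psi chi w).
  have e13 w : a13 (r w) = e2 phi psi w by case: (rho_up phi psi chi w).
  have e24 w : a24 (r w) = e2 psi chi w by case: (rho_up phi psi chi w).
  have e12 w : a12 (r w) = e1 phi w by case: (rho_diag phi psi chi w).
  have e23 w : a23 (r w) = e1 psi w by case: (rho_diag phi psi chi w).
  have split_l v w : lcs F 2 v -> e1 chi w = 0 -> a14 (r (v * w)%g) = a14 (r v) + a14 (r w).
    move=> v2 w0; rewrite rM ut4_mulE /= e12 (e1_lcs2 _ v2) e34 w0; ring.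
  have h2 : lcs F 2 (handle j) by apply: lcs_comm.
  have b0 : e1 chi (bdry_seq s) = 0 by case: (e_bdry_seq chi psi s).
  rewrite big_cons /bdry_seq big_cons -/(bdry_seq s) hM.
  rewrite (split_l (h (handle j))) ?hid //; last exact: lcs_mult.
  rewrite (split_l (handle j)) //.
  rewrite IH /handle (multR hM) !(multR rM).
  rewrite (@ut4_comm_diff (r (x j)) _ (r (y j))) ?e12 ?e23 ?e34 ?hid //.
  rewrite !e13 !e24 !kappaE !e1_gen; ring.
have := key (index_enum 'I_g); rewrite -bdryE hbd => e.
by apply: (addrI (a14 (r (bdry g)))); rewrite addr0 -e.
Qed.

(** The tensor of [h] with its first index raised by the intersection form, which pairs
    [dual (inl k)] with [- y k] and [dual (inr k)] with [x k]. *)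
Definition tensor a phi psi : int :=
  match a with
  | inl k => - kappa h phi psi (y k)
  | inr k => kappa h phi psi (x k)
  end.

Lemma sum_dual_l a (G H : 'I_g -> int) :
  \sum_j (dual a (inl j) * G j - dual a (inr j) * H j) =
  match a with inl k => G k | inr k => - H k end.
Proof.
case: a => k; rewrite (bigD1 k) //= big1 => [|j /negPf jk].
- by rewrite /dual eqxx mul1r mul0r subr0 addr0.
- by rewrite /dual (inj_eq (@inl_inj _ _)) jk !mul0r subr0.
- by rewrite /dual eqxx mul1r mul0r sub0r addr0.
- by rewrite /dual (inj_eq (@inr_inj _ _)) jk !mul0r subr0.
Qed.

Lemma tensor_cyc a b c : tensor c (dual a) (dual b) = tensor a (dual b) (dual c).
Proof.
have := bdry_cubic (dual a) (dual b) (dual c).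
rewrite (eq_bigr (fun j =>
   (dual a (inl j) * kappa h (dual b) (dual c) (y j)
      - dual a (inr j) * kappa h (dual b) (dual c) (x j))
  - (dual c (inl j) * kappa h (dual a) (dual b) (y j)
      - dual c (inr j) * kappa h (dual a) (dual b) (x j)))).
  rewrite sumrB !sum_dual_l => /eqP; rewrite subr_eq0 => /eqP.
  have tE d phi psi : tensor d phi psi = - match d with
      inl k => kappa h phi psi (y k) | inr k => - kappa h phi psi (x k) end.
    by case: d => k //=; rewrite opprK.
  by rewrite !tE => ->.
by move=> j _; ring.
Qed.

Lemma e2_anti phi psi w : lcs F 2 w -> e2 phi psi w = - e2 psi phi w.
Proof.
move=> hw; suff [] : lcs F 2 w /\ e2 phi psi w = - e2 psi phi w by [].
move: w hw; apply: (@lcs_ind _ 0 (fun w => lcs F 2 w /\ e2 phi psi w = - e2 psi phi w)).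
  split=> [|v w]; first by rewrite !e2_1 oppr0; split=> //; apply: lcs1.
  move=> [hv ev] [hw ew]; split; first exact: (lcs_subgroup F 2).2.
  rewrite !(e2_lcs2M _ _ _ hv) !e2V !(e1_lcs2 _ hw) ev ew; ring.
by move=> v w hw; split; [apply: lcs_comm|rewrite !e2R; ring].
Qed.

Lemma tensor_anti a phi psi : tensor a phi psi = - tensor a psi phi.
Proof.
have k z : kappa h phi psi z = - kappa h psi phi z.
  by apply: e2_anti; apply: homology_id_lcs2.
by case: a => j; rewrite /tensor k.
Qed.

End Torelli.

Lemma e1N phi w : e1 (fun t => - phi t) w = - e1 phi w.
Proof.
have fM u v : - e1 phi (u * v)%g = - e1 phi u + - e1 phi v by rewrite e1M opprD.
by rewrite (e1_uniq fM); congr (e1 _ w); apply: funext => t; rewrite e1_gen.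
Qed.

(** The clause with [- dual a] reaches [om (y k) = - dual (inl k)]: realizable
    forms are general functions, whose linearity is recorded only where it is used. *)
Definition tensor_realized (t : I * I * I -> int) := exists2 tau, realizable tau &
  forall a b c, tau (dual a) (dual b) (dual c) = t (a, b, c) /\
    tau (fun d : I => - dual a d) (dual b) (dual c) = - t (a, b, c).

Definition lagrangian_tensor (t : I * I * I -> int) :=
  [/\ forall a b c, t (a, b, c) = - t (a, c, b),
      forall a b c, t (c, a, b) = t (a, b, c) &
      forall j k l, t (inr j, inr k, inr l) = 0].

Lemma realizable_gen a b c : a != b -> b != c -> a != c ->
  is_x a || is_x b || is_x c -> realizable (hdet (fgen a : F) (fgen b) (fgen c)).
Proof.
case: a => i.
  by move=> ab bc ac _; apply: realizable_x1.
case: b => j.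
  move=> ab bc ac _; do 2!apply: realizable_rot.
  by apply: realizable_x1; rewrite // eq_sym.
case: c => k // ab bc ac _; apply: realizable_rot.
by apply: realizable_x1; rewrite // eq_sym.
Qed.

(** At a point [(a, b, c)] of its support such a tensor agrees with a multiple
    of [a /\ b /\ c], which is supported on the permutations of [(a, b, c)]. The three
    indices are distinct and not all of type [y], so that multiple is realizable. *)
Lemma lagrangian_tensor_realized t : lagrangian_tensor t -> tensor_realized t.
Proof.
move: t; apply: support_ind.
  move=> f f0; exists (fun _ _ _ => 0); first exact: realizable0.
  by move=> a b c; rewrite f0 oppr0.
move=> t [[a b] c] [ta tc ty] t0.
pose T := t (a, b, c); rewrite -/T in t0.
have tt p q : t (p, q, q) = 0.
  by apply/eqP; have /eqP := ta p q q; rewrite -subr_eq0 opprK -mulr2n mulrn_eq0.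
have bc : b != c by apply: contraNneq t0 => e; rewrite /T e tt.
have ab : a != b by apply: contraNneq t0 => e; rewrite /T -tc e tc -tc tt.
have ac : a != c by apply: contraNneq t0 => e; rewrite /T e tc tt.
have isx : is_x a || is_x b || is_x c.
  apply: contraNT t0; rewrite /T.
  by case: (a) => //= i; case: (b) => //= j; case: (c) => //= k _; rewrite ty.
pose e (v : I * I * I) := T * hdet (fgen a : F) (fgen b) (fgen c)
  (dual v.1.1) (dual v.1.2) (dual v.2).
have rr := realizableZ T (realizable_gen ab bc ac isx).
exists e; last first.
  move=> [tau rt ht].
  exists (fun chi phi psi => tau chi phi psi +
    T * hdet (fgen a : F) (fgen b) (fgen c) chi phi psi); first exact: realizableD.
  move=> p q r /=; have [-> ->] := ht p q r; rewrite /e /= /hdet !e1N; split; ring.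
split.
- split.
  + by move=> p q r; rewrite ta /e /hdet /=; ring.
  + by move=> p q r; rewrite tc /e /hdet /=; ring.
  move=> j k l; rewrite ty /e /hdet /= !e1_gen.
  move: isx; case: (a) => i; first by move=> _; rewrite /dual /= !mulr0n; ring.
  case: (b) => i'; first by move=> _; rewrite /dual /= !mulr0n; ring.
  by case: (c) => // i'' _; rewrite /dual /= !mulr0n; ring.
- rewrite /e /hdet /= !e1_gen /dual !eqxx.
  rewrite ![_ == a]eq_sym ![c == b]eq_sym (negPf ab) (negPf ac) (negPf bc) /=.
  by rewrite ?mulr1n ?mulr0n /T; ring.
move=> [[p q] r] v0.
have van p' q' r' : t (p', q', r') = 0 ->
    T * ((a == p')%:R * (b == q')%:R * (c == r')%:R) = 0.
  rewrite /T => tv; have [->|_] := eqVneq a p'; last by rewrite !mul0r mulr0.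
  have [->|_] := eqVneq b q'; last by rewrite mulr0 mul0r mulr0.
  by have [->|_] := eqVneq c r'; rewrite ?tv ?mul0r // !mulr0.
(* The six terms of the determinant sit at the six permutations of (p, q, r). *)
have v1 := van _ _ _ v0.
have e2 : t (p, r, q) = 0 by rewrite ta v0.
have e3 : t (r, p, q) = 0 by rewrite tc.
have e4 : t (q, r, p) = 0 by rewrite -tc.
have e5 : t (q, p, r) = 0 by rewrite ta e4.
have e6 : t (r, q, p) = 0 by rewrite ta e3.
have v2 := van _ _ _ e2; have v3 := van _ _ _ e3; have v4 := van _ _ _ e4.
have v5 := van _ _ _ e5; have v6 := van _ _ _ e6.
have : T * ((a == p)%:R * (b == q)%:R * (c == r)%:R) - T * ((a == p)%:R * (b == r)%:R * (c == q)%:R)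
  + T * ((a == q)%:R * (b == r)%:R * (c == p)%:R) - T * ((a == q)%:R * (b == p)%:R * (c == r)%:R)
  + T * ((a == r)%:R * (b == p)%:R * (c == q)%:R)
    - T * ((a == r)%:R * (b == q)%:R * (c == p)%:R) = 0.
  by rewrite v1 v2 v3 v4 v5 v6 ?subr0 ?addr0.
move=> <-; rewrite /e /hdet /= !e1_gen /dual; ring.
Qed.
End Tensor.

(** * Comparison with handlebody classes *)

Section Comparison.
Variable g : nat.
Local Notation I := ('I_g + 'I_g)%type.
Local Notation F := (Fsurf g).
Local Notation x := (@xgen g).
Local Notation y := (@ygen g).
Implicit Types (phi psi chi : I -> int) (z u w U V W : F) (i j k l : 'I_g) (a b c : I).
Local Open Scope ring_scope.

Lemma om_x k : om (x k) = dual (inr k).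
Proof.
apply: funext => -[] j; rewrite /= e1_gen /dual /= ?oppr0 //.
by rewrite (inj_eq (@inl_inj _ _)) (inj_eq (@inr_inj _ _)) eq_sym.
Qed.

Lemma om_y k : om (y k) = (fun a => - dual (inl k) a).
Proof.
apply: funext => -[] j; rewrite /= e1_gen /dual /= ?oppr0 //.
by rewrite (inj_eq (@inl_inj _ _)) (inj_eq (@inr_inj _ _)) eq_sym.
Qed.

Lemma e1_expand phi w : e1 phi w =
  \sum_k (phi (inl k) * e1 (dual (inl k)) w + phi (inr k) * e1 (dual (inr k)) w).
Proof.
pose f v : int := \sum_k (phi (inl k) * e1 (dual (inl k)) v + phi (inr k) * e1 (dual (inr k)) v).
have fM u v : f (u * v)%g = f u + f v.
  by rewrite /f -big_split; apply: eq_bigr => k _; rewrite !e1M /=; ring.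
rewrite -/(f w) (e1_uniq fM); congr (e1 _ w); apply: funext => -[] j; rewrite /f;
  rewrite (bigD1 j) //= big1 => [|k /negPf kj]; rewrite !e1_gen /dual /=.
- by rewrite eqxx mulr1 mulr0 !addr0.
- by rewrite (inj_eq (@inl_inj _ _)) eq_sym kj !mulr0 addr0.
- by rewrite eqxx mulr1 mulr0 add0r addr0.
- by rewrite (inj_eq (@inr_inj _ _)) eq_sym kj !mulr0 addr0.
Qed.

(** Pairing [h (y k)] with [h (x l)] shows that its [y]-part is [y k]; pairing it with
    [h (y i)] shows that its [x]-part is a symmetric matrix. *)
Lemma homology_twist (h h' : F -> F) :
  {morph h : u w / (u * w)%g} -> {morph h' : u w / (u * w)%g} ->
  cancel h h' -> cancel h' h -> h (bdry g) = bdry g ->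
  (forall phi j, e1 phi (h (x j)) = e1 phi (x j)) ->
  exists b b' : F -> F, [/\ haut b b', b (bdry g) = bdry g,
    (forall phi j, e1 phi (b (x j)) = e1 phi (x j)) &
    forall phi z, e1 phi (h z) = e1 phi (b z)].
Proof.
move=> hM h'M hK hK' hbd hx.
have hs : sympl h := bdry_sympl hM h'M hK hK' hbd.
pose m l k := e1 (dual (inl l)) (h (y k)).
have hyy l k : e1 (dual (inr l)) (h (y k)) = (k == l)%:R.
  have := hs (x l) (y k); rewrite (om_homology (w := x l)); last by move=> phi; apply: hx.
  by rewrite om_x e1_gen /dual (inj_eq (@inr_inj _ _)).
have hy phi k : e1 phi (h (y k)) = e1 phi (y k) + \sum_l m l k * e1 phi (x l).
  rewrite [LHS]e1_expand big_split /= addrC; congr (_ + _).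
    rewrite (bigD1 k) //= big1 => [|l /negPf lk]; rewrite hyy ?eqxx ?mulr1 ?addr0 ?e1_gen //.
    by rewrite eq_sym lk mulr0.
  by apply: eq_bigr => l _; rewrite e1_gen mulrC.
have msym i j : m i j = m j i.
  have := hs (y i) (y j); rewrite hy om_yy e1_gen /=.
  rewrite (bigD1 i) //= big1 => [|l /negPf li]; rewrite e1_gen /= hyy.
    by rewrite eqxx mulrN1 addr0 -/(m j i) => /eqP; rewrite subr_eq0 => /eqP ->.
  by rewrite eq_sym li oppr0 mulr0.
have [b [b' [hb bd bx by_]]] := twist_sym msym.
exists b, b'; split=> // phi z; rewrite (e1_comp _ _ hM) (e1_comp _ _ (hautM hb)).
congr (e1 _ z); apply: funext => -[] j; first by rewrite hx bx.
by rewrite hy by_.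
Qed.

(** The Lagrangian condition in degree two kills the components of the tensor indexed
    by three generators of type [y]: these are the quadratic coefficients of
    [i_star (h (x j))] in the free group of the handlebody. *)
Lemma torelli_compare (h : F -> F) :
  {morph h : u w / (u * w)%g} -> homology_id h -> h (bdry g) = bdry g ->
  (forall j, lcs (Fhand g) 3 (i_star (h (x j)))) ->
  exists f f', [/\ haut f f', f (bdry g) = bdry g, homology_id f &
    forall z, eq_mod (lcs F 3) (h z) (f z)].
Proof.
move=> hM hid hbd hx.
pose t (v : I * I * I) := tensor h v.1.1 (dual v.1.2) (dual v.2).
have talt : lagrangian_tensor t.
  split=> [a b c|a b c|j k l]; rewrite /t /=.
  - exact: tensor_anti.
  - exact: tensor_cyc.
  have hc := homology_id_lcs2 (x j) hid.
  have dE i : dual (inr i) = (fun a : I => e1 (dual i) (i_star (fgen a : F))).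
    apply: funext => -[] n; rewrite [i_star _]flift_gen ?e1_1 ?e1_gen /dual //.
  rewrite /kappa !dE -(e2_comp _ _ (@i_starM g) hc) (@i_starM g) (multV (@i_starM g)).
  by rewrite i_star_x invg1 mul1g; apply: e2_lcs3.
have [tau [f [f' [hf fbd [fid fk]]]] ht] := lagrangian_tensor_realized talt.
have fM := hautM hf.
exists f, f'; split=> // z.
have kz a b : kappa f (dual a) (dual b) z = kappa h (dual a) (dual b) z.
  have kfM u v := kappaM (dual a) (dual b) u v fM fid.
  have khM u v := kappaM (dual a) (dual b) u v hM hid.
  rewrite (e1_uniq kfM) (e1_uniq khM); congr (e1 _ z); apply: funext => -[] k.
    have [e _] := ht (inr k) a b.
    by rewrite fk -/(x k) om_x e.
  have [_ e] := ht (inl k) a b.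
  by rewrite fk -/(y k) om_y e /t /= opprK.
have hz := homology_id_lcs2 z hid; have fz := homology_id_lcs2 z fid.
rewrite /eq_mod; have -> : ((h z)^-1 * f z = (z^-1 * h z)^-1 * (z^-1 * f z))%g.
  by rewrite invgM invgK !mulgA mulgK.
apply: lcs3_detect => [|a b]; first by apply: lcsM => //; apply: lcsV.
rewrite (e2_lcs2M _ _ _ (lcsV hz)) e2V (e1_lcs2 _ hz) mul0r sub0r.
by rewrite -!/(kappa _ _ _ _) kz addNr.
Qed.

(** The homological part of [h] is matched first; the quotient [b' \o h] by it is a
    Torelli class that still satisfies the Lagrangian condition, because [b'] induces an
    endomorphism of the handlebody group. *)
Lemma lagrangian_compare (q : nat) (h : mcg g) : q = 1%N \/ q = 2%N -> lagrangian g q h ->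
  exists b b' : F -> F, [/\ haut b b', b (bdry g) = bdry g,
    (forall phi j, e1 phi (b (x j)) = e1 phi (x j)) &
    forall z, eq_mod (lcs F q.+1) (h z) (b z)].
Proof.
move=> hq hL; have [h' [hK hK']] := mcg_has_inv h.
have hM := star_morph h; have h'M := star_morph h'.
have hx phi j : e1 phi (h (x j)) = e1 phi (x j).
  have [_] := hL j => /(e1_lcs2 phi); rewrite e1M e1V => /eqP.
  by rewrite addrC subr_eq0 => /eqP ->.
have [b [b' [hb bbd bx hbz]]] := homology_twist hM h'M hK hK' (star_bdry h) hx.
have bM := hautM hb; have b'M := hautM' hb.
case: hq => eq; rewrite eq in hL *.
  exists b, b'; split=> // z; apply: lcs2_detect => a.
  by rewrite e1M e1V hbz addNr.
pose h2 z := b' (h z).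
have h2M : {morph h2 : u w / (u * w)%g} by move=> u w; rewrite /h2 hM b'M.
have h2id : homology_id h2.
  by move=> phi z; rewrite /h2 (e1_comp _ _ b'M) hbz -(e1_comp _ _ b'M) (hautK hb).
have h2bd : h2 (bdry g) = bdry g by rewrite /h2 star_bdry -[in LHS]bbd (hautK hb).
have h2x j : lcs (Fhand g) 3 (i_star (h2 (x j))).
  have [fb fbM ->] := i_star_factor b'M (haut_x' hb).
  by apply: lcs_mult fbM _; case: (hL j).
have [f [f' [hf fbd fid fz]]] := torelli_compare h2M h2id h2bd h2x.
exists (fun w => b (f w)), (fun w => f' (b' w)); split.
- exact: haut_comp.
- by rewrite fbd bbd.
- by move=> phi j; rewrite (e1_comp _ _ bM) fid -(e1_comp _ _ bM) bx.
move=> z; have := lcs_mult bM (fz z).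
by rewrite /eq_mod bM (multV bM) /h2 (hautK' hb).
Qed.
End Comparison.

Local Close Scope group_scope.

Theorem proposition6p1 (g k : nat) (hk : k = 1 \/ k = 2) :
  lagrangian g k = set_mul (johnson g k) (lagrangian_infty g).
Proof.
have k1 : (1 <= k)%N by case: hk => ->.
apply/seteqP; split=> h /=.
  move=> /(lagrangian_compare hk) [b [b' [hb bbd bx hbz]]].
  pose mb : mcg g := Mcg (hautM hb) (Bijective (hautK hb) (hautK' hb)) bbd.
  exists (h * mb^-1)%g; last first.
    exists mb; last by rewrite mulgVK.
    move=> n _ j; split=> /=; first by rewrite (haut_x hb); apply: lcs1.
    by apply: lcs2_detect => t; rewrite e1M e1V bx addNr.
  move=> w; have := hbz (mcg_inv mb w).
  by rewrite -[b _]/(mb _) (mcg_invK mb).2.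
move=> [a ja [b /(_ k k1) lb <-]] j; have [bx1 bx2] := lb j.
have ab := ja (b (xgen j)); split.
  apply: (eqm_lcs _ bx1); apply: eqm_sym.
  rewrite /eq_mod -(multV (@i_starM g)) -(@i_starM g).
  exact: lcs_mult (@i_starM g) ab.
apply: eqm_trans bx2.
by case: hk ab => ->; [|apply: eqmS].
Qed.
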